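(* Let $(\mathcal{A},\mathcal{A}_* )$ be a dual Banach algebra, and let $\mathcal{U}$ be an ultrafilter on an index set $I$. Let $\mathfrak{A}_* = (\mathcal{A}_* )_{\mathcal{U}}$ and $\mathfrak{A} = (\mathfrak{A}_* )'$, and regard $(\mathcal{A})_{\mathcal{U}}=((\mathcal{A}_* )')_{\mathcal{U}}$ as a closed subspace of $\mathfrak{A}$. The following are equivalent: (1) there is a product on $\mathfrak{A}$ extending the product on $(\mathcal{A})_{\mathcal{U}}$ and turning $(\mathfrak{A},\mathfrak{A}_* )$ into a dual Banach algebra; (2) identifying $(\mathcal{A}_* )_{\mathcal{U}}$ with a subspace of $(\mathcal{A})_{\mathcal{U}}'$, we have $(\mathcal{A}_* )_{\mathcal{U}} \subseteq \operatorname{WAP}((\mathcal{A})_{\mathcal{U}}')$.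
   Context: $E'$ denotes the dual of a Banach space $E$. For an ultrafilter $\mathcal{U}$ on a set $I$, the ultrapower is $(E)_{\mathcal{U}} = \ell^\infty(E,I)/\{(x_i)_{i\in I} : \lim_{i\to\mathcal{U}}\|x_i\|=0\}$, with norm $\|(x_i)\|=\lim_{i\to\mathcal{U}}\|x_i\|$; if $\mathcal{A}$ is a Banach algebra, $(\mathcal{A})_{\mathcal{U}}$ is a Banach algebra under the pointwise product. There is a canonical isometric embedding $(E')_{\mathcal{U}}\to (E)_{\mathcal{U}}'$ given by $\langle(\mu_i),(x_i)\rangle=\lim_{i\to\mathcal{U}}\langle\mu_i,x_i\rangle$. A dual Banach algebra $(\mathcal{A},\mathcal{A}_* )$ is a Banach algebra $\mathcal{A}$ together with a Banach space $\mathcal{A}_*$ with $\mathcal{A}=(\mathcal{A}_* )'$ such that the product on $\mathcal{A}$ is separately weak$^*$-continuous. The identification of $(\mathcal{A}_* )_{\mathcal{U}}$ with a subspace of $(\mathcal{A})_{\mathcal{U}}'$ is by the pairing $\langle (\mu_i),(a_i)\rangle=\lim_{i\to\mathcal{U}}\langle a_i,\mu_i\rangle$. For a Banach algebra $\mathcal{B}$, $\mathcal{B}'$ is a $\mathcal{B}$-bimodule via $\langle a\cdot\mu,b\rangle=\langle\mu,ba\rangle$, $\langle\mu\cdot a,b\rangle=\langle\mu,ab\rangle$. $\operatorname{WAP}(\mathcal{B}')$ is the set of $\mu\in\mathcal{B}'$ such that the map $\mathcal{B}\to\mathcal{B}'$, $a\mapsto a\cdot\mu$, is weakly compact. *)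

(* Defs.v *)
From HB Require Import structures.
From mathcomp Require Import all_boot all_order all_algebra complex.
From mathcomp Require Import boolp classical_sets functions reals topology normedtype.

Set Implicit Arguments.
Unset Strict Implicit.
Unset Printing Implicit Defensive.
Import Order.TTheory GRing.Theory Num.Theory.
Import numFieldNormedType.Exports.
Local Open Scope classical_set_scope.
Local Open Scope ring_scope.
Local Open Scope complex_scope.
Local Open Scope quotient_scope.

Section numfield_limits.
Variable K : numFieldType.

Lemma closed_nneg : closed [set x : K^o | 0 <= x].
Proof.
have -> : [set x : K^o | 0 <= x] = (fun x : K^o => `|x| - x : K^o) @^-1` [set 0].
  apply/seteqP; split => x /=; rewrite ger0_def.
    by move=> /eqP xE; apply/eqP; rewrite subr_eq0 xE.
  by move=> /eqP; rewrite subr_eq0.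
apply: (continuous_closedP _).1; last first.
  exact/accessible_closed_set1/hausdorff_accessible/norm_hausdorff.
move=> x; apply: continuousB; last exact: cvg_id.
exact: norm_continuous.
Qed.

Lemma closed_disc (r : K) : closed [set z : K^o | `|z| <= r].
Proof.
have -> : [set z : K^o | `|z| <= r] =
    (fun z : K^o => r - `|z| : K^o) @^-1` [set x | 0 <= x].
  by apply/seteqP; split => z /=; rewrite subr_ge0.
apply: (continuous_closedP _).1; last exact: closed_nneg.
move=> z; apply: (@continuousB K K^o); last exact: norm_continuous.
exact: cst_continuous.
Qed.

Lemma cvg_le (T : Type) (F : set_system T) (FF : ProperFilter F)
    (f g : T -> K^o) (a b : K^o) :
  f @ F --> a -> g @ F --> b -> (\forall t \near F, f t <= g t) -> a <= b.
Proof.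
move=> fa gb fg; rewrite -subr_ge0.
have h : (fun t => g t - f t) @ F --> (b - a : K^o) by exact: cvgB.
have h0 : \forall t \near F, [set x : K^o | 0 <= x] (g t - f t).
  by apply: filterS fg => t; rewrite /= subr_ge0.
exact: (closed_cvg _ closed_nneg h0 _ h).
Qed.

Lemma cvg_scalar_unique (T : Type) (F : set_system T) (FF : ProperFilter F)
    (f : T -> K^o) (a b : K^o) : f @ F --> a -> f @ F --> b -> a = b.
Proof. by move=> fa fb; exact: (cvg_unique (@norm_hausdorff _ K^o) fa fb). Qed.

End numfield_limits.

Section complex_scalars.
Variable R : realType.
Local Notation C := R[i].

Lemma normr_real_complex (x : R) : `|x%:C| = `|x|%:C.
Proof. by rewrite normc_def /= expr0n /= addr0 sqrtr_sqr. Qed.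

Lemma ler_norm_complex (z : C) : `|z| <= (`|complex.Re z| + `|complex.Im z|)%:C.
Proof.
rewrite {1}[z]complexE (le_trans (ler_normD _ _))// normrM.
have -> : `|'i%C| = 1 :> C by rewrite normc_def /= expr0n expr1n add0r sqrtr1.
by rewrite mul1r !normr_real_complex -rmorphD.
Qed.

Lemma complex_gt0P (e : C) : 0 < e -> exists2 d : R, 0 < d & e = d%:C.
Proof.
case: e => a b; rewrite ltcE /= => /andP[/eqP -> a0]; by exists a.
Qed.

Lemma continuous_complex :
  continuous (fun p : R * R => (p.1 +i* p.2)%C : C^o).
Proof.
case=> x y; apply/cvgrPdist_lt => _ /complex_gt0P[d d0 ->].
have d20 : 0 < d / 2 by rewrite divr_gt0.
exists (ball x (d / 2), ball y (d / 2)).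
  by split; apply: nbhsx_ballx.
case=> x' y' /= [xx' yy']; rewrite (le_lt_trans (ler_norm_complex _))//= ltcR.
by rewrite [d]splitr ltrD.
Qed.

Lemma disc_compact (r : C) : compact [set z : C^o | `|z| <= r].
Proof.
pose s := complex.Re r.
apply: (@subclosed_compact _ _
  ((fun p : R * R => (p.1 +i* p.2)%C : C^o) @` (`[- s, s] `*` `[- s, s]))).
- exact: (@closed_disc C).
- apply: continuous_compact.
    exact/continuous_subspaceT/continuous_complex.
  by apply: compact_setX; apply: segment_compact.
- case=> a b /=; rewrite normc_def lecE /= => /andP[_ h].
  exists (a, b) => //=; split; rewrite /= in_itv /= -ler_norml;
    apply: le_trans h; rewrite -sqrtr_sqr ler_wsqrtr //.
    by rewrite lerDl sqr_ge0.
  by rewrite lerDr sqr_ge0.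
Qed.

Lemma complex_cauchy_cvg (F : set_system C^o) :
  ProperFilter F -> cauchy F -> exists l : C^o, F --> l.
Proof.
move=> FF /cauchy_ballP Fc.
have [z0 Fz0] : exists z0, F (ball z0 1).
  have /nearP_dep := Fc 1 ltr01; move=> /filter_ex[z hz]; by exists z.
have Fd : F [set z : C^o | `|z| <= `|z0| + 1].
  apply: filterS Fz0 => z /= hz.
  rewrite -[z](subKr z0) (le_trans (ler_normB _ _))// lerD2l.
  exact: ltW.
have [l [_ Fl]] := @disc_compact (`|z0| + 1) F FF Fd.
exists l; apply/cvgrPdist_lt => e e0.
have e20 : 0 < e / 2 by rewrite divr_gt0.
have [[A B] [/= FA FB] AB] := Fc _ e20.
have [w [Aw lw]] := Fl A (ball l (e / 2)) FA (nbhsx_ballx _ _ e20).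
apply: filterS FB => z Bz.
have -> : l - z = (l - w) + (w - z) by rewrite addrA subrK.
rewrite (le_lt_trans (ler_normD _ _))// [e]splitr ltrD//.
exact: (AB (w, z)).
Qed.

Lemma ultra_cvg (I : Type) (U : set_system I) (UU : UltraFilter U)
    (f : I -> C^o) (M : C) :
  (forall i, `|f i| <= M) -> f @ U --> (lim (f @ U) : C^o).
Proof.
move=> fM.
suff [l fl] : exists l : C^o, f @ U --> l by apply: (cvgP l fl).
have FU : ProperFilter U := @ultra_proper _ _ UU.
have fU : U (f @^-1` [set z : C^o | `|z| <= M]) by apply: filterE.
have [l [_ fl]] := @disc_compact M (f @ U) _ fU.
exists l => A Al; rewrite /nbhs /=.
have [//|nA] := in_ultra_setVsetC (f @^-1` A) UU.
by have [x [/= ]] := fl (~` A) A nA Al.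
Qed.

End complex_scalars.

Section dual.
Variables (R : realType) (E : normedModType R[i]).
Local Notation C := R[i].

Definition is_functional (f : E -> C^o) : Prop := linear f /\ continuous f.

Definition functionals : {pred E -> C^o} := [pred f | `[< is_functional f >]].

Lemma functionals_submod_closed : submod_closed functionals.
Proof.
split; first by apply/asboolP; split=> [a x y|x] /=; [rewrite scaler0 addr0|exact: cvg_cst].
move=> a f g /asboolP[fl fc] /asboolP[gl gc]; apply/asboolP; split.
  move=> b x y; rewrite !fctE fl gl !scalerDr !scalerA (mulrC a b).
  by rewrite -!addrA; congr (_ + _); rewrite addrCA.
move=> x; apply: (@cvgD _ C^o _ _ (nbhs_filter x)); last exact: gc.
by apply: (@cvgZl_tmp _ C^o _ _ (nbhs_filter x)); exact: fc.
Qed.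

HB.instance Definition _ := GRing.isSubmodClosed.Build C (E -> C^o)
  functionals functionals_submod_closed.

Record dual := Dual { dual_fun :> E -> C^o ; _ : dual_fun \in functionals }.

HB.instance Definition _ := [isSub for dual_fun].
HB.instance Definition _ := [Choice of dual by <:].
HB.instance Definition _ := [SubChoice_isSubLmodule of dual by <:].

Lemma dual_is_functional (f : dual) : is_functional f.
Proof. by case: f => f ff; apply/asboolP. Qed.

Lemma dual_linear (f : dual) : linear f.
Proof. exact: (dual_is_functional f).1. Qed.

HB.instance Definition _ (f : dual) :=
  GRing.isLinear.Build C E C^o *:%R (dual_fun f) (dual_linear f).

Lemma dual_continuous (f : dual) : continuous f.
Proof. exact: (dual_is_functional f).2. Qed.

Lemma dualP (f g : dual) : f =1 g -> f = g.
Proof. by move=> fg; apply/val_inj/funext. Qed.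

Lemma dualDZE (c : C) (f g : dual) x : (c *: f + g) x = c *: f x + g x.
Proof. by []. Qed.

Lemma functionalP (f : E -> C^o) (M : C) :
  linear f -> (forall x, `|f x| <= M * `|x|) -> f \in functionals.
Proof.
move=> fl fM; apply/asboolP; split=> // x.
have fB y : f x - f y = f (x - y).
  by have := fl (-1) y x; rewrite !scaleN1r ![- _ + _]addrC => ->.
have M1 : 0 < `|M| + 1 by rewrite ltr_pwDr.
apply/(@cvgrPdist_lt _ C^o) => e e0.
have := nbhsx_ballx x _ (divr_gt0 e0 M1); rewrite -ball_normE.
apply: filterS => y /= xy; rewrite fB (le_lt_trans (fM _))//.
rewrite (@le_lt_trans _ _ ((`|M| + 1) * `|x - y|))//; last first.
  by rewrite mulrC -ltr_pdivlMr.
have : 0 <= M * `|x - y| by exact: le_trans (fM (x - y)).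
move=> /ger0_norm <-; rewrite normrM normr_id.
by rewrite ler_wpM2r// lerDl.
Qed.

(* The norm of a module over R[i] takes its values in R[i], hence the injection
   of the real supremum. *)
Definition dual_norm (f : dual) : C :=
  (sup [set complex.Re `|f x| | x in [set x : E | `|x| <= 1]])%:C.

Let Re_normK (z : C) : (complex.Re `|z|)%:C = `|z|.
Proof. by rewrite RRe_real// normr_real. Qed.

Lemma dual_bounded (f : dual) : exists2 M : R, 0 < M &
  forall x, `|f x| <= M%:C * `|x|.
Proof.
have /linear_bounded_continuous/linear_boundedP := @dual_continuous f.
move=> /pinfty_ex_gt0[_ /complex_gt0P[M M0 ->] fM]; by exists M.
Qed.

Lemma dual_norm_has_sup (f : dual) :
  has_sup [set complex.Re `|f x| | x in [set x : E | `|x| <= 1]].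
Proof.
split; first by exists (complex.Re `|f 0|); exists 0; rewrite //= normr0 ler01.
have [M M0 fM] := dual_bounded f.
exists M => _ [x /= x1 <-]; rewrite -lecR Re_normK (le_trans (fM x))//.
by rewrite ler_piMr// ler0c ltW.
Qed.

Lemma dual_norm_ge0 (f : dual) : 0 <= dual_norm f.
Proof.
rewrite /dual_norm ler0c; apply: (@le_trans _ _ (complex.Re `|f 0|)).
  by rewrite raddf0 normr0.
apply: sup_upper_bound; first exact: dual_norm_has_sup.
by exists 0; rewrite //= normr0 ler01.
Qed.

Lemma dual_norm_ub (f : dual) (x : E) : `|f x| <= dual_norm f * `|x|.
Proof.
have [->|x0] := eqVneq x 0; first by rewrite raddf0 !normr0 mulr0.
have nx : 0 < `|x| by rewrite normr_gt0.
rewrite -ler_pdivrMr// -[`|x|]normr_id -normfV -normrM mulrC.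
rewrite -[_ * f x]/(_ *: f x) -linearZ -Re_normK lecR.
apply: sup_upper_bound; first exact: dual_norm_has_sup.
by exists (`|x|^-1 *: x) => //=; rewrite normrZ normfV normr_id mulVf// gt_eqF.
Qed.

Lemma dual_norm_le (f : dual) (M : C) :
  0 <= M -> (forall x, `|f x| <= M * `|x|) -> dual_norm f <= M.
Proof.
move=> M0 fM; rewrite /dual_norm -(RRe_real (ger0_real M0)) lecR.
apply: ge_sup; first by have [] := dual_norm_has_sup f.
move=> _ [x /= x1 <-]; rewrite -lecR Re_normK (RRe_real (ger0_real M0)).
by rewrite (le_trans (fM x))// ler_piMr.
Qed.

Lemma dual_ler_normD (f g : dual) :
  dual_norm (f + g) <= dual_norm f + dual_norm g.
Proof.
apply: dual_norm_le; first by rewrite addr_ge0 ?dual_norm_ge0.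
move=> x; rewrite mulrDl (le_trans (ler_normD _ _))// lerD//;
  exact: dual_norm_ub.
Qed.

Lemma dual_normrZ (a : C) (f : dual) : dual_norm (a *: f) = `|a| * dual_norm f.
Proof.
have le b g : dual_norm (b *: g) <= `|b| * dual_norm g.
  apply: dual_norm_le; first by rewrite mulr_ge0 ?dual_norm_ge0.
  by move=> x; rewrite normrM -mulrA ler_wpM2l ?dual_norm_ub.
apply/eqP; rewrite eq_le le /=.
have [->|a0] := eqVneq a 0; first by rewrite normr0 mul0r dual_norm_ge0.
rewrite -ler_pdivlMl ?normr_gt0// -normfV.
by rewrite -{1}[f](scalerK a0) le.
Qed.

Lemma dual_norm0_eq0 (f : dual) : dual_norm f = 0 -> f = 0.
Proof.
move=> f0; apply/dualP => x; apply/eqP; rewrite -normr_le0.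
by rewrite (le_trans (dual_norm_ub _ _))// f0 mul0r.
Qed.

HB.instance Definition _ := Lmodule_isNormed.Build C dual
  dual_ler_normD dual_normrZ dual_norm0_eq0.

Lemma ler_dual_norm (f : dual) (x : E) : `|f x| <= `|f| * `|x|.
Proof. exact: dual_norm_ub. Qed.

Lemma dual_norm_approx (f : dual) (e : C) : 0 < e ->
  exists x : E, `|x| <= 1 /\ `|f| <= `|f x| + e.
Proof.
move=> /complex_gt0P[d d0 ->].
have [_ [x /= x1 <-] xf] := sup_adherent d0 (dual_norm_has_sup f).
exists x; split=> //; rewrite -lerBlDr -[`|f x|]Re_normK.
by rewrite -[`|f|]/(dual_norm f) -rmorphB lecR ltW.
Qed.

Lemma dual_cauchy_cvg (F : set_system dual) :
  ProperFilter F -> cauchy F -> cvg F.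
Proof.
move=> FF /cauchy_ballP Fc.
have Fx (x : E) : exists l : C^o, (fun f : dual => f x : C^o) @ F --> l.
  apply: complex_cauchy_cvg; apply/cauchy_ballP => e e0.
  have x1 : 0 < `|x| + 1 by rewrite ltr_pwDr.
  have [[A B] [/= FA FB] AB] := Fc _ (divr_gt0 e0 x1).
  exists ((fun f : dual => f x) @` A, (fun f : dual => f x) @` B).
    by split; [apply: filterS FA => f Af|apply: filterS FB => f Bf]; exists f.
  case=> _ _ /= [[f Af <-] [g Bg <-]].
  have fg : `|f - g| < e / (`|x| + 1) := AB (f, g) (conj Af Bg).
  rewrite /ball /= -[f x - g x]/((f - g) x).
  rewrite (le_lt_trans (ler_dual_norm _ _))//.
  move: fg; rewrite ltr_pdivlMr//; apply: le_lt_trans.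
  by rewrite ler_wpM2l// lerDl.
have {Fx} [l Fl] := choice Fx.
have [f0 Ff0] : exists f0, F (ball f0 1).
  have /nearP_dep := Fc 1 ltr01; move=> /filter_ex[z hz]; by exists z.
have ll : linear l.
  move=> a x y.
  have h : (fun f : dual => f (a *: x + y) : C^o) @ F --> (a *: l x + l y : C^o).
    under eq_fun do rewrite linearP.
    by apply: (@cvgD _ C^o); [apply: (@cvgZl_tmp _ C^o); exact: Fl|exact: Fl].
  exact: (cvg_unique (@norm_hausdorff _ C^o) (Fl _) h).
have lb x : `|l x| <= (`|f0| + 1) * `|x|.
  apply: (cvg_le FF (f := fun f : dual => `|f x|) (g := cst ((`|f0| + 1) * `|x|))).
  - exact: (@cvg_norm _ C^o _ _ _ _ _ (Fl x)).
  - exact: cvg_cst.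
  - apply: filterS Ff0 => f; rewrite /ball /= => f01.
    rewrite (le_trans (ler_dual_norm _ _))// ler_wpM2r//.
    rewrite -[f](subKr f0) (le_trans (ler_normB _ _))// lerD2l.
    exact: ltW.
apply/cvg_ex; exists (Dual (functionalP ll lb)).
apply/cvgrPdist_le => e e0.
have [[A B] [/= FA FB] AB] := Fc _ e0.
apply: filterS FA => f Af; apply: dual_norm_le; first exact: ltW.
move=> x; rewrite -[X in `|X|]/(l x - f x) distrC.
apply: (cvg_le FF (f := fun g : dual => `|f x - g x|) (g := cst (e * `|x|))).
- apply: (@cvg_norm _ C^o); apply: (@cvgB _ C^o); [exact: cvg_cst|exact: Fl].
- exact: cvg_cst.
- apply: filterS FB => g Bg; rewrite -[f x - g x]/((f - g) x).
  rewrite (le_trans (ler_dual_norm _ _))// ler_wpM2r//.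
  by apply: ltW; exact: (AB (f, g)).
Qed.

HB.instance Definition _ := Uniform_isComplete.Build dual dual_cauchy_cvg.

End dual.

Section linfty.
Variables (R : realType) (I : Type) (E : normedModType R[i]).
Local Notation C := R[i].

Definition bounded_family (x : I -> E) : Prop :=
  exists M : C, forall i, `|x i| <= M.

Definition bounded_families : {pred I -> E} := [pred x | `[< bounded_family x >]].

Lemma bounded_families_submod_closed : submod_closed bounded_families.
Proof.
split; first by apply/asboolP; exists 0 => i; rewrite normr0.
move=> a x y /asboolP[M xM] /asboolP[N yN]; apply/asboolP.
exists (`|a| * M + N) => i; rewrite !fctE (le_trans (ler_normD _ _))// lerD//.
by rewrite normrZ ler_wpM2l.
Qed.

HB.instance Definition _ := GRing.isSubmodClosed.Build C (I -> E)
  bounded_families bounded_families_submod_closed.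

(* The sup norm of linfty is not needed: the norm of the ultrapower is the limit
   of the norms of the components of a representative (see norm_uclass). *)
Record linfty := Linfty { family :> I -> E; _ : family \in bounded_families }.

HB.instance Definition _ := [isSub for family].
HB.instance Definition _ := [Choice of linfty by <:].
HB.instance Definition _ := [SubChoice_isSubLmodule of linfty by <:].

Lemma linfty_bounded (x : linfty) : exists2 M : C, 0 < M & forall i, `|x i| <= M.
Proof.
have /asboolP[M xM] : family x \in bounded_families by case: x.
exists (`|M| + 1) => [|i]; first by rewrite ltr_pwDr.
rewrite (le_trans (xM i))//; have : 0 <= M by rewrite (le_trans _ (xM i)).
by move=> /ger0_norm ->; rewrite lerDl.
Qed.

Lemma linftyDZE (c : C) (x y : linfty) i : (c *: x + y) i = c *: x i + y i.
Proof. by []. Qed.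

Lemma bounded_familyP (x : I -> E) (M : C) :
  (forall i, `|x i| <= M) -> x \in bounded_families.
Proof. by move=> xM; apply/asboolP; exists M. Qed.

End linfty.

Section ultrapower.
Variables (R : realType) (I : Type) (U : set_system I).
Context {UU : UltraFilter U}.
Variable E : normedModType R[i].
Local Notation C := R[i].
Implicit Types x y : linfty I E.

Definition null_family x : Prop := (fun i => `|x i| : C^o) @ U --> (0 : C^o).

Definition null_families : {pred linfty I E} := [pred x | `[< null_family x >]].

Lemma null_family_le x (g : I -> C^o) :
  (forall i, `|x i| <= g i) -> g @ U --> (0 : C^o) -> null_family x.
Proof.
move=> xg g0; apply/(@cvgrPdist_lt _ C^o) => e e0.
have /(@cvgrPdist_lt _ C^o)/(_ e e0) := g0.
apply: filterS => i; rewrite !sub0r !normrN normr_id.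
by rewrite (ger0_norm (le_trans _ (xg i)))//; apply: le_lt_trans.
Qed.

Lemma null_families_zmod_closed : zmod_closed null_families.
Proof.
split.
  apply/asboolP; rewrite /null_family.
  by under eq_fun do rewrite normr0; exact: cvg_cst.
move=> x y /asboolP x0 /asboolP y0; apply/asboolP.
apply: (null_family_le (g := fun i => `|x i| + `|y i|)).
  by move=> i; exact: ler_normB.
by rewrite -[X in _ --> X]addr0; apply: (@cvgD _ C^o).
Qed.

HB.instance Definition _ := GRing.isZmodClosed.Build (linfty I E)
  null_families null_families_zmod_closed.

Definition ultrapower := Quotient.quot null_families.

HB.instance Definition _ := GRing.Zmodule.on ultrapower.
HB.instance Definition _ := EqQuotient.on ultrapower.

Definition uclass x : ultrapower := \pi_ultrapower x.

Lemma uclass_eqP x y : uclass x = uclass y <-> null_family (x - y).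
Proof.
rewrite /uclass; split=> [/eqP|xy].
  by rewrite -Quotient.idealrBE => /asboolP.
by apply/eqP; rewrite -Quotient.idealrBE; apply/asboolP.
Qed.

Lemma uclass_repr (a : ultrapower) : uclass (repr a) = a.
Proof. exact: reprK. Qed.

Lemma uclassD x y : uclass (x + y) = uclass x + uclass y.
Proof. by rewrite /uclass piE. Qed.

Lemma uclassB x y : uclass (x - y) = uclass x - uclass y.
Proof. by rewrite /uclass !piE. Qed.

Lemma null_family_repr x : null_family (repr (uclass x) - x).
Proof. by apply/uclass_eqP; rewrite uclass_repr. Qed.

Lemma null_familyZ (a : C) x : null_family x -> null_family (a *: x).
Proof.
move=> x0; apply: (null_family_le (g := fun i => `|a| * `|x i|)).
  by move=> i; rewrite -normrZ.
by rewrite -[X in _ --> X](mulr0 `|a|); apply: (@cvgZl_tmp _ C^o).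
Qed.

Definition uscale (c : C) (a : ultrapower) : ultrapower :=
  uclass (c *: repr a).

Lemma uscale_uclass c x : uscale c (uclass x) = uclass (c *: x).
Proof.
apply/uclass_eqP; rewrite -scalerBr; apply: null_familyZ.
exact: null_family_repr.
Qed.

Fact uscalerA c d a : uscale c (uscale d a) = uscale (c * d) a.
Proof. by rewrite -[a]uclass_repr !uscale_uclass scalerA. Qed.

Fact uscale1r : left_id 1 uscale.
Proof. by move=> a; rewrite -[a]uclass_repr uscale_uclass scale1r. Qed.

Fact uscalerDr : right_distributive uscale +%R.
Proof.
move=> c a b; rewrite -[a]uclass_repr -[b]uclass_repr.
by rewrite -uclassD !uscale_uclass -uclassD scalerDr.
Qed.

Fact uscalerDl a : {morph uscale^~ a : c d / c + d}.
Proof.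
by move=> c d; rewrite -[a]uclass_repr !uscale_uclass -uclassD scalerDl.
Qed.

HB.instance Definition _ := GRing.Zmodule_isLmodule.Build C ultrapower
  uscalerA uscale1r uscalerDr uscalerDl.

Lemma uclassZ c x : uclass (c *: x) = c *: uclass x.
Proof. by rewrite -uscale_uclass. Qed.

Definition unorm (a : ultrapower) : C := lim ((fun i => `|repr a i| : C^o) @ U).

Lemma unorm_uclass x : (fun i => `|x i| : C^o) @ U --> (unorm (uclass x) : C^o).
Proof.
set r := repr (uclass x).
have rU : (fun i => `|r i| : C^o) @ U --> (unorm (uclass x) : C^o).
  have [M _ rM] := linfty_bounded r.
  by apply: (@ultra_cvg _ _ _ _ _ M) => i; rewrite normr_id.
have d0 : (fun i => `|r i - x i| : C^o) @ U --> (0 : C^o).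
  exact: null_family_repr.
have h : (fun i => `|x i| - `|r i| : C^o) @ U --> (0 : C^o).
  apply/(@cvgrPdist_lt _ C^o) => e e0.
  have /(@cvgrPdist_lt _ C^o)/(_ e e0) := d0.
  apply: filterS => i; rewrite !sub0r !normrN normr_id; apply: le_lt_trans.
  by rewrite distrC ler_dist_dist.
rewrite -[unorm _]add0r.
have -> : (fun i => `|x i| : C^o) = (fun i => `|x i| - `|r i|) + (fun i => `|r i|).
  by apply/funext => i; rewrite fctE subrK.
exact: (@cvgD _ C^o _ _ _ _ _ _ _ h rU).
Qed.

Lemma unorm_unique x (l : C^o) :
  (fun i => `|x i| : C^o) @ U --> l -> unorm (uclass x) = l.
Proof.
exact: (cvg_scalar_unique ultra_proper (@unorm_uclass x)).
Qed.

Fact uler_normD a b : unorm (a + b) <= unorm a + unorm b.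
Proof.
rewrite -[a]uclass_repr -[b]uclass_repr -uclassD.
apply: (cvg_le ultra_proper (@unorm_uclass _)
  (@cvgD _ C^o _ _ _ _ _ _ _ (@unorm_uclass _) (@unorm_uclass _))).
by apply: nearW => i; exact: ler_normD.
Qed.

Fact unormrZ c a : unorm (c *: a) = `|c| * unorm a.
Proof.
rewrite -[a]uclass_repr -uclassZ; apply: unorm_unique.
under eq_fun do rewrite normrZ.
by apply: (@cvgZl_tmp _ C^o); exact: unorm_uclass.
Qed.

Fact unorm0_eq0 a : unorm a = 0 -> a = 0.
Proof.
rewrite -[a]uclass_repr => a0.
have -> : 0 = uclass 0 :> ultrapower by rewrite -[in RHS](subrr 0) uclassB subrr.
by apply/uclass_eqP; rewrite subr0 /null_family -a0; exact: unorm_uclass.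
Qed.

HB.instance Definition _ := Lmodule_isNormed.Build C ultrapower
  uler_normD unormrZ unorm0_eq0.

Lemma norm_uclass x : (fun i => `|x i| : C^o) @ U --> (`|uclass x| : C^o).
Proof. exact: unorm_uclass. Qed.

Lemma norm_uclass_le x (M : C) :
  (\forall i \near U, `|x i| <= M) -> `|uclass x| <= M.
Proof.
by move=> xM; apply: (cvg_le ultra_proper (@norm_uclass x) (@cvg_cst C^o M _ _ _) xM).
Qed.

End ultrapower.

Arguments ultrapower {R I} U {UU} E.
Arguments uclass {R I} U {UU E} x.

Section ultrapower_complete.
Variables (R : realType) (I : Type) (U : set_system I).
Context {UU : UltraFilter U}.
Variable E : completeNormedModType R[i].
Local Notation C := R[i].

Let d (n : nat) : C := (n.+1%:R^-1)%:C.

Let d_gt0 n : 0 < d n.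
Proof. by rewrite ltcR invr_gt0 ltr0n. Qed.

Let d_anti m n : (m <= n)%N -> d n <= d m.
Proof. by move=> mn; rewrite lecR lef_pV2 ?posrE ?ltr0n// ler_nat ltnS. Qed.

Let d_small (k : nat) (e : C) : 0 < e -> exists n, d n *+ k < e.
Proof.
move=> /complex_gt0P[r r0 ->].
have kr0 : 0 <= k%:R / r by rewrite divr_ge0 ?ler0n ?ltW.
exists (Num.bound (k%:R / r)); rewrite -rmorphMn /= ltcR -mulr_natl.
rewrite ltr_pdivrMr ?ltr0n// -ltr_pdivrMl// mulrC.
by rewrite (lt_trans (archi_boundP kr0))// ltr_nat ltnS.
Qed.

Let near_norm_lt (x : linfty I E) (M : C) :
  `|uclass U x| < M -> \forall i \near U, `|x i| <= M.
Proof.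
move=> xM; have /(@cvgrPdist_lt _ C^o) := @norm_uclass _ _ U UU _ x.
move=> /(_ (M - `|uclass U x|)); rewrite subr_gt0 => /(_ xM).
apply: filterS => i; rewrite distrC => xi.
rewrite -[M](subrK `|uclass U x|) -lerBlDr (le_trans _ (ltW xi))//.
by apply: real_ler_norm; rewrite rpredB ?normr_real.
Qed.

Lemma ultrapower_cauchy_cvg (F : set_system (ultrapower U E)) :
  ProperFilter F -> cauchy F -> cvg F.
Proof.
move=> FF /cauchy_ballP Fc.
have /choice[a Fa] : forall n, exists z : ultrapower U E, F (ball z (d n)).
  move=> n; by have /nearP_dep := Fc _ (d_gt0 n); move=> /filter_ex[z hz]; exists z.
have aa m n : `|a m - a n| < d m + d n.
  have [z [amz anz]] : exists z, ball (a m) (d m) z /\ ball (a n) (d n) z.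
    exact: filter_ex (filterI (Fa m) (Fa n)).
  have -> : a m - a n = (a m - z) - (a n - z) by rewrite opprB addrA subrK.
  by rewrite (le_lt_trans (ler_normB _ _))// ltrD.
pose f n := repr (a n).
pose P n i := forall k l, (k <= n)%N -> (l <= n)%N -> `|f k i - f l i| <= d k + d l.
have UP n : U [set i | P n i].
  have h (k l : 'I_n.+1) : \forall i \near U, `|f k i - f l i| <= d k + d l.
    have := @near_norm_lt (f k - f l) (d k + d l).
    by rewrite uclassB !uclass_repr; apply; exact: aa.
  have : \forall i \near U, forall k l : 'I_n.+1, `|f k i - f l i| <= d k + d l.
    by apply: filter_forall => k; apply: filter_forall => l; exact: h.
  apply: filterS => i hi k l kn ln.
  have := hi (Ordinal (kn : (k < n.+1)%N)) (Ordinal (ln : (l < n.+1)%N)).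
  exact.
have P_anti m n i : (m <= n)%N -> P n i -> P m i.
  by move=> mn Pn k l km lm; apply: Pn; exact: leq_trans mn.
pose g := fix g n i := if n is m.+1 then
  (if `[< P n i >] then f n i else g m i) else f 0%N i.
have gP n i : P n i -> g n i = f n i.
  by case: n => //= n Pn; rewrite asboolT.
have g_cases m n i : (n <= m)%N -> g m i = g n i \/
    exists k, [/\ (n <= k)%N, P k i & g m i = f k i].
  elim: m => [|m IH]; first by rewrite leqn0 => /eqP ->; left.
  rewrite leq_eqVlt => /predU1P[->|nm]; first by left.
  have [Pm|Pm] := pselect (P m.+1 i).
    by right; exists m.+1; split=> //; [exact: ltnW|rewrite /= asboolT].
  by rewrite /= asboolF//; exact: IH.
have g_cauchy m n i : (n <= m)%N -> `|g m i - g n i| <= d n *+ 2.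
  move=> nm; have [->|[k [nk Pk ->]]] := g_cases m n i nm.
    by rewrite subrr normr0 mulrn_wge0// ltW.
  rewrite (gP n)//; last exact: P_anti Pk.
  by rewrite (le_trans (Pk _ _ (leqnn _) nk))// mulr2n lerD2r d_anti.
have /choice[h gh] : forall i, exists l : E, (fun n => g n i) @ \oo --> l.
  move=> i; apply/cvg_ex; apply: cauchy_cvg; apply: cauchy_exP => e e0.
  have [N Ne] := d_small 2 e0; exists (g N i); exists N => // n /= Nn.
  by rewrite -ball_normE /= distrC (le_lt_trans (g_cauchy _ _ i Nn)).
have h_near n i : `|h i - g n i| <= d n *+ 2.
  have c : (fun m => `|g m i - g n i| : C^o) @ \oo --> (`|h i - g n i| : C^o).
    by apply: (@cvg_norm _ E); apply: cvgB; [exact: gh|exact: cvg_cst].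
  apply: (cvg_le _ c (@cvg_cst C^o (d n *+ 2) _ _ _)).
  by exists n => // m /= nm; exact: g_cauchy.
have hb : h \in @bounded_families R I E.
  have [M _ fM] := linfty_bounded (f 0%N).
  apply: (bounded_familyP (M := M + d 0%N *+ 2)) => i.
  rewrite -[h i](subrK (g 0%N i)) addrC (le_trans (ler_normD _ _))// lerD//.
  exact: fM.
pose x := @uclass R I U UU E (Linfty hb).
have xa n : `|x - a n| <= d n *+ 2.
  rewrite -[a n]uclass_repr -uclassB; apply: norm_uclass_le.
  by apply: filterS (UP n) => i Pi; rewrite /= -[X in `|X|]/(h i - f n i) -(gP _ _ Pi).
apply/cvg_ex; exists x; apply/cvgrPdist_lt => e e0.
have [n ne] := d_small 3 e0; apply: filterS (Fa n) => z az.
have -> : x - z = (x - a n) + (a n - z) by rewrite addrA subrK.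
rewrite (le_lt_trans (ler_normD _ _))//.
by rewrite (lt_le_trans _ (ltW ne))// mulrSr ler_ltD.
Qed.

HB.instance Definition _ := Uniform_isComplete.Build (ultrapower U E)
  ultrapower_cauchy_cvg.

End ultrapower_complete.

Lemma cvg_null_comb (R : realType) (I : Type) (U : set_system I)
    (UU : UltraFilter U) (E F : normedModType R[i]) (u : linfty I E)
    (v : linfty I F) (M N : R[i]) :
  null_family U u -> null_family U v ->
  (fun i => M * `|u i| + N * `|v i| : R[i]^o) @ U --> (0 : R[i]^o).
Proof.
move=> u0 v0; have -> : (0 : R[i]^o) = M * 0 + N * 0 by rewrite !mulr0 addr0.
by apply: (@cvgD _ R[i]^o); apply: (@cvgZl_tmp _ R[i]^o).
Qed.

Section weak_topologies.
Variable R : realType.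
Local Notation C := R[i].

(* The topology sigma(E, E'): the coarsest one making all f in E' continuous. *)
Definition weak (E : normedModType C) : topologicalType :=
  @initial_topology E {ptws dual E -> C^o} (fun x f => f x).

(* The topology sigma(E', E). *)
Definition weak_star (E : normedModType C) : topologicalType :=
  @initial_topology (dual E) {ptws E -> C^o} (fun f x => f x).

(* Used for linear T: the image of the unit ball is relatively weakly compact. *)
Definition weakly_compact (E F : normedModType C) (T : E -> F) : Prop :=
  compact (closure (T @` [set x : E | `|x| <= 1] : set (weak F))).

End weak_topologies.

Section banach_product.
Variables (R : realType) (B : completeNormedModType R[i]).
Local Notation C := R[i].

(* No unit is required of a Banach algebra, so the ring structures of the
   algebraic hierarchy, which are unital, do not apply. *)
Record banach_product := BanachProduct {
  bprod :> B -> B -> B;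
  bprodA : associative bprod;
  bprodPl : forall c x y z, bprod (c *: x + y) z = c *: bprod x z + bprod y z;
  bprodPr : forall c x y z, bprod x (c *: y + z) = c *: bprod x y + bprod x z;
  ler_norm_bprod : forall x y, `|bprod x y| <= `|x| * `|y| }.

Variable m : banach_product.

Lemma bprodBl x y z : m (x - y) z = m x z - m y z.
Proof. by rewrite addrC -scaleN1r bprodPl scaleN1r addrC. Qed.

Lemma bprodBr x y z : m x (y - z) = m x y - m x z.
Proof. by rewrite addrC -scaleN1r bprodPr scaleN1r addrC. Qed.

Section dual_lact.
Variables (a : B) (mu : dual B).

Let lact_fun (b : B) : C^o := mu (m b a).

Fact dual_lact_linear : linear lact_fun.
Proof. by move=> c x y; rewrite /lact_fun bprodPl linearP. Qed.

Fact dual_lact_bounded b : `|lact_fun b| <= `|mu| * `|a| * `|b|.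
Proof.
rewrite (le_trans (ler_dual_norm _ _))// -mulrA ler_wpM2l//.
by rewrite [_ * `|b|]mulrC ler_norm_bprod.
Qed.

(* <a . mu, b> = <mu, b a> *)
Definition dual_lact : dual B :=
  Dual (functionalP dual_lact_linear dual_lact_bounded).

End dual_lact.

Definition WAP : set (dual B) :=
  [set mu | weakly_compact (fun a : B => dual_lact a mu)].

End banach_product.

(* The Banach algebra of the pair is the dual of E itself, so the structure
   consists of the product m alone. *)
Definition dual_banach_algebra (R : realType) (E : completeNormedModType R[i])
    (m : banach_product (dual E)) : Prop :=
  forall a : dual E, continuous (m a : weak_star E -> weak_star E) /\
                     continuous (m ^~ a : weak_star E -> weak_star E).

Section ultrapower_product.
Variables (R : realType) (I : Type) (U : set_system I).
Context {UU : UltraFilter U}.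
Variables (B : completeNormedModType R[i]) (m : banach_product B).
Local Notation C := R[i].
Local Notation BU := (ultrapower U B).

Fact linfty_prod_bounded (x y : linfty I B) :
  (fun i => m (x i) (y i)) \in @bounded_families R I B.
Proof.
have [M M0 xM] := linfty_bounded x; have [N N0 yN] := linfty_bounded y.
apply: (bounded_familyP (M := M * N)) => i.
by rewrite (le_trans (ler_norm_bprod _ _ _))// ler_pM.
Qed.

Definition linfty_prod (x y : linfty I B) : linfty I B :=
  Linfty (linfty_prod_bounded x y).

Definition ultra_prod (a b : BU) : BU := uclass U (linfty_prod (repr a) (repr b)).

Lemma ultra_prod_uclass (x y : linfty I B) :
  ultra_prod (uclass U x) (uclass U y) = uclass U (linfty_prod x y).
Proof.
apply/uclass_eqP.
set x' := repr (uclass U x); set y' := repr (uclass U y).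
have [M M0 xM] := linfty_bounded x'; have [N N0 yN] := linfty_bounded y.
apply: (null_family_le (g := fun i => M * `|(y' - y) i| + N * `|(x' - x) i|)).
  move=> i; have -> : (linfty_prod x' y' - linfty_prod x y) i =
      m (x' i) ((y' - y) i) + m ((x' - x) i) (y i).
    by rewrite bprodBr bprodBl addrA subrK.
  rewrite (le_trans (ler_normD _ _))// lerD//.
    by rewrite (le_trans (ler_norm_bprod _ _ _))// ler_wpM2r.
  by rewrite (le_trans (ler_norm_bprod _ _ _))// mulrC ler_wpM2r.
by apply: cvg_null_comb; exact: null_family_repr.
Qed.

Fact ultra_prodA : associative ultra_prod.
Proof.
move=> a b c; rewrite -[a]uclass_repr -[b]uclass_repr -[c]uclass_repr.
rewrite !ultra_prod_uclass; congr (uclass U _).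
by apply/val_inj/funext => i; rewrite /= bprodA.
Qed.

Fact ultra_prodPl c x y z :
  ultra_prod (c *: x + y) z = c *: ultra_prod x z + ultra_prod y z.
Proof.
rewrite -[x]uclass_repr -[y]uclass_repr -[z]uclass_repr.
rewrite -uclassZ -uclassD !ultra_prod_uclass -uclassZ -uclassD.
by congr (uclass U _); apply/val_inj/funext => i; exact: bprodPl.
Qed.

Fact ultra_prodPr c x y z :
  ultra_prod x (c *: y + z) = c *: ultra_prod x y + ultra_prod x z.
Proof.
rewrite -[x]uclass_repr -[y]uclass_repr -[z]uclass_repr.
rewrite -uclassZ -uclassD !ultra_prod_uclass -uclassZ -uclassD.
by congr (uclass U _); apply/val_inj/funext => i; exact: bprodPr.
Qed.

Fact ler_norm_ultra_prod x y : `|ultra_prod x y| <= `|x| * `|y|.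
Proof.
rewrite -[x]uclass_repr -[y]uclass_repr ultra_prod_uclass.
apply: (cvg_le ultra_proper (@norm_uclass _ _ U UU _ _)
  (@cvgM _ _ _ _ _ _ _ _ (@norm_uclass _ _ U UU _ _) (@norm_uclass _ _ U UU _ _))).
by apply: nearW => i; exact: ler_norm_bprod.
Qed.

Definition ultra_product : banach_product BU :=
  BanachProduct ultra_prodA ultra_prodPl ultra_prodPr ler_norm_ultra_prod.

End ultrapower_product.

Arguments ultra_product {R I} U {UU B} m.

Section ultrapower_pairing.
Variables (R : realType) (I : Type) (U : set_system I).
Context {UU : UltraFilter U}.
Variable E : normedModType R[i].
Local Notation C := R[i].

Definition ultra_pairing (a : ultrapower U (dual E)) (x : ultrapower U E) : C^o :=
  lim ((fun i => repr a i (repr x i) : C^o) @ U).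

Lemma cvg_ultra_pairing (a : linfty I (dual E)) (x : linfty I E) :
  (fun i => a i (x i) : C^o) @ U --> ultra_pairing (uclass U a) (uclass U x).
Proof.
rewrite /ultra_pairing.
set a' := repr (uclass U a); set x' := repr (uclass U x).
have [M M0 aM] := linfty_bounded a'; have [N N0 xN] := linfty_bounded x'.
have [P P0 aP] := linfty_bounded a.
have h : (fun i => a' i (x' i) : C^o) @ U --> (lim ((fun i => a' i (x' i) : C^o) @ U) : C^o).
  apply: (@ultra_cvg _ _ _ _ _ (M * N)) => i.
  by rewrite (le_trans (ler_dual_norm _ _))// ler_pM.
rewrite -[X in _ --> X]subr0.
have -> : (fun i => a i (x i) : C^o) =
    (fun i => a' i (x' i)) - (fun i => a' i (x' i) - a i (x i)).
  by apply/funext => i; rewrite !fctE opprB addrC subrK.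
apply: (@cvgB _ C^o); first exact: h.
pose g i : C^o := N * `|(a' - a) i| + P * `|(x' - x) i|.
have g0 : g @ U --> (0 : C^o) by apply: cvg_null_comb; exact: null_family_repr.
have le_g i : `|a' i (x' i) - a i (x i)| <= g i.
  have -> : a' i (x' i) - a i (x i) = (a' - a) i (x' i) + a i ((x' - x) i).
    by rewrite linearB /= addrA -[X in X + _ - _]/(a' i (x' i) - a i (x' i)) subrK.
  rewrite (le_trans (ler_normD _ _))// lerD//.
    by rewrite (le_trans (ler_dual_norm _ _))// mulrC ler_wpM2r.
  by rewrite (le_trans (ler_dual_norm _ _))// ler_wpM2r.
apply/(@cvgrPdist_lt _ C^o) => e e0.
have /(@cvgrPdist_lt _ C^o)/(_ e e0) := g0.
apply: filterS => i; rewrite !sub0r !normrN.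
by rewrite (ger0_norm (le_trans _ (le_g i)))//; apply: le_lt_trans.
Qed.

Let cvg_comb (c : C) (f g : I -> C^o) (k l : C^o) :
  f @ U --> k -> g @ U --> l ->
  (fun i => c *: f i + g i : C^o) @ U --> (c *: k + l : C^o).
Proof.
have FU : Filter U := @filter_filter _ _ (@ultra_proper _ _ UU).
move=> fk gl.
have h := @cvgZl_tmp C C^o I U FU c f k fk.
exact: (@cvgD C C^o I U FU (c \*: f) g (c *: k) l h gl).
Qed.

Lemma ultra_pairing_linearl x : linear (ultra_pairing ^~ x).
Proof.
move=> c a b; rewrite -[a]uclass_repr -[b]uclass_repr -[x]uclass_repr.
rewrite -uclassZ -uclassD.
apply: (cvg_scalar_unique ultra_proper (@cvg_ultra_pairing _ _)).
under eq_fun do rewrite linftyDZE dualDZE.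
exact: cvg_comb (@cvg_ultra_pairing _ _) (@cvg_ultra_pairing _ _).
Qed.

Lemma ultra_pairing_linearr a : linear (ultra_pairing a).
Proof.
move=> c x y; rewrite -[a]uclass_repr -[x]uclass_repr -[y]uclass_repr.
rewrite -uclassZ -uclassD.
apply: (cvg_scalar_unique ultra_proper (@cvg_ultra_pairing _ _)).
under eq_fun do rewrite linearP.
exact: cvg_comb (@cvg_ultra_pairing _ _) (@cvg_ultra_pairing _ _).
Qed.

Lemma ler_norm_ultra_pairing a x : `|ultra_pairing a x| <= `|a| * `|x|.
Proof.
rewrite -[a]uclass_repr -[x]uclass_repr.
apply: (cvg_le ultra_proper (@cvg_norm _ C^o _ _ _ _ _ (@cvg_ultra_pairing _ _))
  (@cvgM _ _ _ _ _ _ _ _ (@norm_uclass _ _ U UU _ _) (@norm_uclass _ _ U UU _ _))).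
by apply: nearW => i; exact: ler_dual_norm.
Qed.

Fact ler_norm_ultra_pairing_sym x a : `|ultra_pairing a x| <= `|x| * `|a|.
Proof. by rewrite mulrC ler_norm_ultra_pairing. Qed.

(* The canonical map (E')_U -> ((E)_U)', isometric by norm_dual_embedding. *)
Definition dual_embedding (a : ultrapower U (dual E)) : dual (ultrapower U E) :=
  Dual (functionalP (ultra_pairing_linearr a) (ler_norm_ultra_pairing a)).

Lemma norm_dual_embedding (a : ultrapower U (dual E)) :
  `|dual_embedding a| = `|a|.
Proof.
apply/eqP; rewrite eq_le; apply/andP; split.
  exact: (@dual_norm_le _ _ (dual_embedding a) _ (normr_ge0 a)
    (ler_norm_ultra_pairing a)).
apply/ler_addgt0Pr => e e0; rewrite -[in `|a|](uclass_repr a).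
have /choice[x xP] := fun i => dual_norm_approx (repr a i) e0.
pose X := Linfty (bounded_familyP (fun i => (xP i).1)).
have X1 : `|uclass U X| <= 1.
  by apply: norm_uclass_le; apply: nearW => i; exact: (xP i).1.
have aX : `|ultra_pairing a (uclass U X)| <= `|dual_embedding a|.
  rewrite (le_trans (ler_dual_norm (dual_embedding a) (uclass U X)))//.
  by rewrite ler_piMr.
have FU : Filter U := @filter_filter _ _ (@ultra_proper _ _ UU).
have c : (fun i => `|repr a i (X i)| + e : C^o) @ U -->
    (`|ultra_pairing a (uclass U X)| + e : C^o).
  have := @cvg_ultra_pairing (repr a) X; rewrite uclass_repr => h.
  have h' := @cvg_norm C C^o I U FU _ _ h.
  exact: (@cvgD C C^o I U FU _ _ _ _ h' (@cvg_cst C^o e _ _ FU)).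
apply: le_trans (cvg_le ultra_proper (@norm_uclass _ _ U UU _ _) c _) _.
  by apply: nearW => i; exact: (xP i).2.
by rewrite lerD2r.
Qed.

(* The canonical map (E)_U -> ((E')_U)', given by the same pairing. *)
Definition predual_embedding (x : ultrapower U E) : dual (ultrapower U (dual E)) :=
  Dual (functionalP (ultra_pairing_linearl x) (ler_norm_ultra_pairing_sym x)).

End ultrapower_pairing.

(* Main.v *)
Require Import Defs.
From HB Require Import structures.
From mathcomp Require Import all_boot all_order all_algebra complex.
From mathcomp Require Import boolp classical_sets functions reals topology normedtype.
From mathcomp Require Import ring lra.

(** Write X for the ultrapower of E, B for that of E', and j : X -> B' for the
    canonical embedding, which is isometric by Hahn-Banach.

    If a product on X' makes X its predual, then every functional
    Phi' |-> <Phi' Phi, x> is weak*-continuous, hence given by an element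
    Phi . x of X, and Phi |-> j (Phi . x) is weak*-to-weak continuous.  It maps
    the weak*-compact unit ball of X' onto a weakly compact set containing all
    the a . j x with a in the unit ball of B.

    Conversely, Goldstine's theorem and weak compactness give, for mu in
    WAP(B') and L, G in B'', the identity <G, L . mu> = <L, mu . G> (equality
    of the two Arens products on mu).  As E is an E'-submodule of E'', range j
    is a closed sub-bimodule of B', and the identity together with Hahn-Banach
    shows that it is stable under both actions of B''.  So each Phi in X' acts
    on X from both sides, and <Phi Psi, x> = <Phi, Psi . x> = <Psi, x . Phi>
    defines a product; the two expressions make it weak*-continuous in each
    variable. *)

Set Implicit Arguments.
Unset Strict Implicit.
Unset Printing Implicit Defensive.
Import Order.TTheory GRing.Theory Num.Theory.
Import numFieldNormedType.Exports.
Local Open Scope classical_set_scope.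
Local Open Scope ring_scope.
Local Open Scope complex_scope.

(** * The Hahn-Banach theorem over the complex numbers *)

Section hahn_banach.
Variables (R : realType) (V : lmodType R[i]).
Local Notation C := R[i].

(** Homogeneity is asked only as an inequality, which passes easily to infima; [sublinearZ] recovers
    the equality. *)
Definition sublinear (p : V -> R) : Prop :=
  (forall x y, p (x + y) <= p x + p y) /\
  (forall t x, 0 <= t -> p (t%:C *: x) <= t * p x).

Lemma sublinear0_ge0 (p : V -> R) : sublinear p -> 0 <= p 0.
Proof. by move=> [pD _]; have := pD 0 0; rewrite addr0; lra. Qed.

Lemma sublinearZ (p : V -> R) t x :
  sublinear p -> 0 <= t -> p (t%:C *: x) = t * p x.
Proof.
move=> sp; rewrite le_eqVlt => /predU1P[<-|t0].
  have := sp.2 0 0 (lexx 0); rewrite !scale0r !mul0r => p0.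
  by apply/eqP; rewrite eq_le p0 sublinear0_ge0.
apply/eqP; rewrite eq_le (sp.2 t x (ltW t0)) andTb.
have ti : 0 <= t^-1 by rewrite invr_ge0 ltW.
have := sp.2 t^-1 (t%:C *: x) ti.
by rewrite scalerA -rmorphM /= mulVf ?gt_eqF// scale1r ler_pdivlMl.
Qed.

Lemma sublinearN (p : V -> R) x : sublinear p -> - p (- x) <= p x.
Proof.
move=> sp; have := sublinear0_ge0 sp; have := sp.1 x (- x).
by rewrite subrr; lra.
Qed.

(** The lower bound [l] keeps the infimum finite, and the other two conditions let near-minimisers
    be combined into one index. It serves for chains in Zorn's lemma, for modifying a minimal
    functional, and for the domination in [hahn_banach]. *)
Lemma inf_sublinear (T : Type) (P : T -> V -> R) (l : V -> R) (i0 : T) :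
  (forall i x, l x <= P i x) ->
  (forall i j x y, exists k, P k (x + y) <= P i x + P j y) ->
  (forall i t x, 0 <= t -> exists k, P k (t%:C *: x) <= t * P i x) ->
  exists2 p, sublinear p & forall i x, p x <= P i x.
Proof.
move=> lP PD PZ; pose S x := [set P i x | i in setT].
have infS x : has_inf (S x).
  split; first by exists (P i0 x); exists i0.
  by exists (l x) => _ [i _ <-].
have leP i x : inf (S x) <= P i x by apply: ge_inf; [exact: (infS x).2|exists i].
have infP x (e : R) : 0 < e -> exists i, P i x < inf (S x) + e.
  by move=> e0; have [_ [i _ <-] ie] := inf_adherent e0 (infS x); exists i.
exists (fun x => inf (S x)) => //; split=> [x y|t x t0].
  apply/ler_addgt0Pr => e e0; have e2 : 0 < e / 2 by rewrite divr_gt0.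
  have [i xi] := infP x _ e2; have [j yj] := infP y _ e2.
  have [k ijk] := PD i j x y; have := leP k (x + y); lra.
apply/ler_addgt0Pr => e e0; have t1 : 0 < t + 1 by lra.
have [i xi] := infP x _ (divr_gt0 e0 t1); have [k ik] := PZ i t x t0.
apply: le_trans (leP k _) _; apply: le_trans ik _.
apply: (@le_trans _ _ (t * (inf (S x) + e / (t + 1)))).
  by rewrite ler_wpM2l// ltW.
rewrite mulrDr lerD2l mulrCA ler_piMr ?(ltW e0)//.
by rewrite ler_pdivrMr// mul1r lerDl.
Qed.

(** Zorn's lemma for the reversed pointwise order: a nonempty chain is bounded by its infimum,
    finite because every sublinear [q] below [p] satisfies [- p (- x) <= q x]. *)
Lemma exists_minimal_sublinear (p : V -> R) : sublinear p ->
  exists q, [/\ sublinear q, forall x, q x <= p x &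
    forall q', sublinear q' -> (forall x, q' x <= q x) -> q' = q].
Proof.
move=> sp; pose T := {q : V -> R | sublinear q /\ forall x, q x <= p x}.
pose le (q r : T) := `[< forall x, sval r x <= sval q x >].
have [|q r s /asboolP qr /asboolP rs|q r /asboolP qr /asboolP rq|A totA|] :=
    @Zorn T le.
- by move=> q; apply/asboolP.
- by apply/asboolP => x; exact: le_trans (rs x) (qr x).
- case: q r qr rq => [q Pq] [r Pr] /= qr rq.
  have E : q = r by apply/funext => x; apply/eqP; rewrite eq_le rq qr.
  by subst r; congr exist; exact: Prop_irrelevance.
- have [[a0 Aa0]|A0] := pselect (A !=set0); last first.
    exists (exist _ p (conj sp (fun x => lexx _))) => q Aq.
    by case: A0; exists q.
  have [|||r sr rA] := @inf_sublinear {q | A q} (fun q => sval (sval q))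
      (fun x => - p (- x)) (exist _ a0 Aa0).
  + move=> [[q [sq qp]] Aq] x /=; apply: le_trans (sublinearN x sq).
    by rewrite lerN2.
  + move=> [q Aq] [r Ar] x y /=.
    have [/asboolP qr|/asboolP rq] := totA _ _ Aq Ar.
      exists (exist _ r Ar) => /=; apply: le_trans ((svalP r).1.1 x y) _.
      by rewrite lerD2r.
    exists (exist _ q Aq) => /=; apply: le_trans ((svalP q).1.1 x y) _.
    by rewrite lerD2l.
  + by move=> [q Aq] t x t0; exists (exist _ q Aq); exact: (svalP q).1.2.
  + have rp x : r x <= p x.
      exact: le_trans (rA (exist _ a0 Aa0) x) ((svalP a0).2 x).
    exists (exist _ r (conj sr rp)) => q Aq; apply/asboolP => x /=.
    exact: rA (exist _ q Aq) x.
- move=> [q [sq qp]] maxq; exists q; split=> // q' sq' q'q.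
  have q'p x : q' x <= p x by exact: le_trans (q'q x) (qp x).
  by have /(congr1 sval) := maxq (exist _ q' (conj sq' q'p)) (asboolT q'q).
Qed.

(** A minimal [f] is linear: the infimum over [t >= 0] of [f (z + t y) - t f y] majorises a
    sublinear functional below [f], which is [f] itself by minimality, and [t = 1] gives
    [f x + f y <= f (x + y)]. *)
Lemma real_linear_le_sublinear (p : V -> R) : sublinear p ->
  exists f : V -> R, [/\ forall x y, f (x + y) = f x + f y,
    forall t x, f (t%:C *: x) = t * f x & forall x, f x <= p x].
Proof.
move=> /exists_minimal_sublinear[f [sf fp minf]].
have fD x y : f (x + y) = f x + f y.
  apply/eqP; rewrite eq_le sf.1 /=.
  have [|||g sg gP] := @inf_sublinear {t : R | 0 <= t}
    (fun t z => f (z + (sval t)%:C *: y) - sval t * f y)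
    (fun z => - f (- z)) (exist _ 0 (lexx 0)).
  - move=> [t t0] z /=; have := sf.1 (z + t%:C *: y) (- z).
    by rewrite addrAC subrr add0r sublinearZ//; lra.
  - move=> [s s0] [t t0] z w /=; exists (exist _ (s + t) (addr_ge0 s0 t0)) => /=.
    have := sf.1 (z + s%:C *: y) (w + t%:C *: y).
    by rewrite addrACA -scalerDl -rmorphD; lra.
  - move=> [s s0] t z t0 /=; exists (exist _ (t * s) (mulr_ge0 t0 s0)) => /=.
    have := sf.2 t (z + s%:C *: y) t0.
    by rewrite scalerDr scalerA -rmorphM; lra.
  - have g_le_f z : g z <= f z.
      by have := gP (exist _ 0 (lexx 0)) z; rewrite /= scale0r addr0 mul0r subr0.
    have := gP (exist _ 1 ler01) x; rewrite (minf _ sg g_le_f) /= scale1r mul1r.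
    by lra.
have f0 : f 0 = 0 by have := fD 0 0; rewrite addr0; lra.
have fN x : f (- x) = - f x by have := fD x (- x); rewrite subrr f0; lra.
exists f; split=> // t x; have [t0|t0] := leP 0 t; first exact: sublinearZ.
have nt0 : 0 <= - t by lra.
by have := sublinearZ x sf nt0; rewrite rmorphN scaleNr fN; lra.
Qed.

End hahn_banach.

(** * Complex extension, norming and separating functionals *)

Section hahn_banach_complex.
Variables (R : realType) (V : normedModType R[i]).
Local Notation C := R[i].

Let Re_normK (W : normedModType C) (z : W) : (complex.Re `|z|)%:C = `|z|.
Proof. by rewrite RRe_real// normr_real. Qed.

Let ReD (a b : C) : complex.Re (a + b) = complex.Re a + complex.Re b.
Proof. by case: a => ? ?; case: b. Qed.

Let ReZ (t : R) (a : C) : complex.Re (t%:C * a) = t * complex.Re a.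
Proof. by case: a => a b /=; rewrite mul0r subr0. Qed.

Let Re_le_norm (z : C) : complex.Re z <= complex.Re `|z|.
Proof.
by case: z => a b /=; rewrite (le_trans (ler_norm a))// -sqrtr_sqr ler_wsqrtr//
  lerDl sqr_ge0.
Qed.

(* The real form of the theorem dominates [Re g] on the range of [j] by the
   sublinear functional [v |-> inf_x (k |v + j x| - Re (g x))], and
   [v |-> f v - i f (i v)] is then complex linear. *)
Theorem hahn_banach (W : lmodType C) (j : W -> V) (g : W -> C^o) (k : R) :
  linear j -> linear g -> 0 <= k -> (forall x, `|g x| <= k%:C * `|j x|) ->
  exists2 F : dual V, forall x, F (j x) = g x & `|F| <= k%:C.
Proof.
move=> jl gl k0 gk.
pose J : {linear W -> V} := HB.pack j (GRing.isLinear.Build _ _ _ _ j jl).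
pose G : {linear W -> C^o} := HB.pack g (GRing.isLinear.Build _ _ _ _ g gl).
have jD x y : j (x + y) = j x + j y := raddfD J x y.
have jN x : j (- x) = - j x := raddfN J x.
have j0 : j 0 = 0 := raddf0 J.
have jZ a x : j (a *: x) = a *: j x by rewrite -[a *: x]addr0 jl j0 addr0.
have gD x y : g (x + y) = g x + g y := raddfD G x y.
have gN x : g (- x) = - g x := raddfN G x.
have g0 : g 0 = 0 := raddf0 G.
have gZ a x : g (a *: x) = a * g x by rewrite -[a *: x]addr0 gl g0 addr0.
pose q (v : V) := k * complex.Re `|v|.
have qD v w : q (v + w) <= q v + q w.
  rewrite /q -mulrDr ler_wpM2l// -lecR rmorphD /= !Re_normK; exact: ler_normD.
have qZ t v : 0 <= t -> q (t%:C *: v) = t * q v.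
  by move=> t0; rewrite /q normrZ normr_real_complex ReZ ger0_norm// mulrCA.
have gq x : complex.Re (g x) <= q (j x).
  rewrite (le_trans (Re_le_norm _))// -lecR /q rmorphM /= !Re_normK; exact: gk.
have [|||p sp pP] := @inf_sublinear R V W
    (fun x v => q (v + j x) - complex.Re (g x)) (fun v => - q (- v)) 0.
- move=> x v; have := gq x; have := qD (v + j x) (- v).
  by rewrite addrAC subrr add0r; lra.
- move=> x y v w; exists (x + y).
  rewrite jD gD ReD.
  by have := qD (v + j x) (w + j y); rewrite addrACA; lra.
- move=> x t v t0; exists (t%:C *: x); 
  rewrite jZ gZ.
  by rewrite -scalerDr qZ// ReZ mulrBr.
have [f [fD fZ fp]] := real_linear_le_sublinear sp.
have f0 : f 0 = 0 by have := fD 0 0; rewrite addr0; lra.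
have fN v : f (- v) = - f v by have := fD v (- v); rewrite subrr f0; lra.
have fq v : f v <= q v.
  apply: le_trans (fp v) _; have := pP 0 v.
  by rewrite j0 g0 addr0 subr0.
(* At [- j y] the bound [pP y] reduces to [- Re (g y)]; applied to [x] and [- x] it gives both
   inequalities. *)
have fj x : f (j x) = complex.Re (g x).
  have le y : f (- j y) <= - complex.Re (g y).
    apply: le_trans (fp _) _; apply: le_trans (pP y _) _.
    by rewrite addNr /q normr0 mulr0 sub0r.
  apply/eqP; rewrite eq_le; have := le x; have := le (- x).
  rewrite jN gN opprK fN.
  by rewrite -[complex.Re (- _)]/(complex.Re (- g x)); case: (g x) => a b /=; lra.
pose F v : C^o := (f v +i* - f ('i%C *: v))%C.
have Fl : linear F.
  case=> a b v w.
  have fC (c d : R) u : f ((c +i* d)%C *: u) = c * f u + d * f ('i%C *: u).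
    by rewrite [(c +i* d)%C]complexE /= ['i%C * _]mulrC scalerDl fD fZ -scalerA fZ.
  have iE : 'i%C * (a +i* b)%C = (- b +i* a)%C :> C.
    by apply/eqP; rewrite eq_complex /=; apply/andP; split; apply/eqP; ring.
  have f1 : f ((a +i* b)%C *: v + w) = a * f v + b * f ('i%C *: v) + f w.
    by rewrite fD (fC a b v).
  have f2 : f ('i%C *: ((a +i* b)%C *: v + w)) =
      - b * f v + a * f ('i%C *: v) + f ('i%C *: w).
    by rewrite scalerDr fD scalerA iE (fC (- b) a v).
  rewrite /F f1 f2; apply/eqP; rewrite eq_complex /=.
  by apply/andP; split; apply/eqP; ring.
have Fk v : `|F v| <= k%:C * `|v|.
  have [->|z0] := eqVneq (F v) 0; first by rewrite normr0 mulr_ge0 ?ler0c.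
  (* [c] rotates [F v] to its modulus, so that the bound [fq] on the real part [f] controls all of
     [F]. *)
  pose c : C := `|F v| / F v.
  have nz0 : `|F v| != 0 by rewrite normr_eq0.
  have c1 : `|c| = 1 by rewrite normrM normfV normr_id mulfV.
  have : F (c *: v) = `|F v|.
    have F0 : F 0 = 0 by rewrite /F scaler0 f0 oppr0.
    by have := Fl c v 0; rewrite addr0 F0 addr0 => ->; exact: mulfVK.
  move=> /(congr1 (@complex.Re R)) Fc; rewrite [LHS]/= in Fc.
  rewrite -(Re_normK (F v)) -(Re_normK v) -rmorphM lecR -Fc.
  by rewrite (le_trans (fq _))// /q normrZ c1 mul1r.
exists (Dual (functionalP Fl Fk)); last first.
  by apply: dual_norm_le; rewrite ?ler0c.
move=> x; rewrite /= /F fj -jZ fj.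
rewrite gZ.
case: (g x) => a b /=; apply/eqP; rewrite eq_complex /=.
by apply/andP; split; apply/eqP; ring.
Qed.

Corollary norming_functional (v : V) :
  exists2 f : dual V, f v = `|v| & `|f| <= 1.
Proof.
have [||||F Fv F1] := @hahn_banach C^o (fun c => c *: v) (fun c => c * `|v|) 1.
- by move=> a x y; rewrite scalerDl scalerA.
- by move=> a x y; rewrite mulrDl -[a *: x]/(a * x) -mulrA.
- exact: ler01.
- by move=> x; rewrite mul1r normrM normr_id normrZ.
by exists F => //; have := Fv 1; rewrite scale1r mul1r.
Qed.

(* [d * |c| <= |j x + c *: v|], so [j x + c *: v |-> d * c] extends to [V]. *)
Corollary separating_functional (W : lmodType C) (j : W -> V) (v : V) (d : R) :
  linear j -> 0 < d -> (forall x, d%:C <= `|v - j x|) ->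
  exists2 F : dual V, forall x, F (j x) = 0 & F v != 0.
Proof.
move=> jl d0 dj.
pose J : {linear W -> V} := HB.pack j (GRing.isLinear.Build _ _ _ _ j jl).
have j0 : j 0 = 0 := raddf0 J.
have jZ a x : j (a *: x) = a *: j x by rewrite -[a *: x]addr0 jl j0 addr0.
have [||||F FE _] := @hahn_banach (W * C^o)%type (fun p => j p.1 + p.2 *: v)
    (fun p => d%:C * p.2) 1.
- move=> a [x b] [y c] /=; rewrite jl scalerDl -scalerA scalerDr.
  by rewrite addrACA.
- move=> a [x b] [y c] /=.
  by rewrite mulrDr -[a *: _]/(a * _) -[a *: (_ * _)]/(a * (_ * _)) mulrCA.
- exact: ler01.
- move=> [x c] /=; rewrite mul1r; have [->|c0] := eqVneq c 0.
    by rewrite mulr0 normr0.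
  have -> : j x + c *: v = c *: (v - j (- c^-1 *: x)).
    rewrite jZ scalerBr scaleNr scalerN opprK addrC scalerA mulfV//.
    by rewrite scale1r.
  rewrite normrM normrZ mulrC ler_wpM2l//.
  by rewrite normr_real_complex gtr0_norm.
exists F => [x|].
  by have := FE (x, 0); rewrite /= scale0r addr0 mulr0.
have := FE (0, 1); rewrite /= j0 add0r scale1r mulr1 => ->.
by rewrite gt_eqF ?ltcR.
Qed.

End hahn_banach_complex.

(** * Weak and weak* topologies *)

Section weak_convergence.
Variable R : realType.
Local Notation C := R[i].

Lemma cvg_initial (S : choiceType) (T : topologicalType) (f : S -> T)
    (F : set_system S) (x : S) : Filter F ->
  (F --> (x : initial_topology f)) <-> (f @ F --> f x).
Proof.
move=> FF; split=> [Fx A Ax|Fx A /= [_ [[O Oop <-] Ox OA]]].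
  exact/Fx/(@initial_continuous S T f x).
have /Fx FO : nbhs (f x) O by rewrite nbhsE; exists O.
exact: (@filterS _ F FF _ _ OA FO).
Qed.

Lemma cvg_initial_ptws (S : choiceType) (K : eqType) (ev : S -> K -> C^o)
    (F : set_system S) (x : S) : Filter F ->
  (F --> (x : @initial_topology S {ptws K -> C^o} ev)) <->
  (forall k, (fun y => ev y k) @ F --> ev x k).
Proof.
move=> FF; have FFe : Filter (ev @ F) by exact: fmap_filter.
split=> [/cvg_initial Fx k|Fk].
  move=> A Ak; apply: (Fx ((fun g => g k) @^-1` A)).
  exact: (@proj_continuous K (fun=> C^o) k (ev x)).
apply/cvg_initial/cvg_sup => k.
exact/(@cvg_initial (K -> C^o) C^o (fun f => f k) (ev @ F) (ev x) FFe)/Fk.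
Qed.

Lemma cvg_weak (E : normedModType C) (F : set_system E) (x : E) : Filter F ->
  (F --> (x : weak E)) <-> (forall f : dual E, (fun y => f y) @ F --> f x).
Proof. exact: (@cvg_initial_ptws E (dual E) (fun x f => f x)). Qed.

Lemma cvg_weak_star (E : normedModType C) (F : set_system (dual E)) (f : dual E) :
  Filter F ->
  (F --> (f : weak_star E)) <->
  (forall x, (fun g : dual E => g x : C^o) @ F --> f x).
Proof. exact: (@cvg_initial_ptws (dual E) E (fun g x => g x)). Qed.

Lemma dual_linearZ (E : normedModType C) (f : dual E) (a : C) x :
  f (a *: x) = a * f x.
Proof. by rewrite linearZ. Qed.

Section base.
Variables (T : Type) (K : eqType) (ev : T -> K -> C^o) (l : K -> C^o) (D : set T).

(** Trace on [D] of the basic neighbourhoods of [l] for pointwise convergence on [K]. The limit [l]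
    is a mere function, so it may be an element of the bidual approached from [E]. *)
Definition ptws_base (p : seq K * R) : set T :=
  [set t | D t /\ forall k, k \in p.1 -> `|l k - ev t k| < p.2%:C].

Definition ptws_filter : set_system T :=
  filter_from [set p : seq K * R | 0 < p.2] ptws_base.

Lemma ptws_filter_filter : Filter ptws_filter.
Proof.
apply: filter_from_filter; first by exists ([::], 1) => /=; exact: ltr01.
move=> [s d] [t e] /= d0 e0; exists (s ++ t, Order.min d e) => /=.
  by rewrite lt_min d0.
move=> x [Dx xP]; split; split=> // k ks; move: (xP k);
  rewrite /= mem_cat ks ?orbT => /(_ isT)/lt_le_trans; apply;
  by rewrite lecR ge_min lexx ?orbT.
Qed.

Lemma ptws_filter_proper :
  (forall s (e : R), 0 < e -> ptws_base (s, e) !=set0) -> ProperFilter ptws_filter.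
Proof.
by move=> bP; apply: filter_from_proper ptws_filter_filter _ => -[s e]; exact: bP.
Qed.

Lemma ptws_filter_cvg k : (fun t => ev t k) @ ptws_filter --> l k.
Proof.
have FF := ptws_filter_filter.
apply/(@cvgrPdist_lt _ C^o) => _ /complex_gt0P[e e0 ->].
by exists ([:: k], e) => // t [_ /(_ k)]; apply; rewrite inE.
Qed.

Lemma ptws_filterD : ptws_filter D.
Proof. by exists ([::], 1); [exact: ltr01|move=> t []]. Qed.

End base.

(** Induction on [s]. If evaluation at [x] vanishes on the common kernel of the others, [x] is
    dropped; otherwise some [u] kills [s] with [u x = 1], and [phi] minus [phi u] times evaluation
    at [x] is handled by induction. *)
Lemma functional_span (E : normedModType C) (s : seq E) (phi : dual E -> C^o) :
  linear phi ->
  (forall f : dual E, (forall x, x \in s -> f x = 0) -> phi f = 0) ->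
  exists y, forall f, phi f = f y.
Proof.
elim: s phi => [|x s IH] phi phil phis.
  by exists 0 => f; rewrite raddf0 phis.
have phi0 : phi 0 = 0 by apply: phis => y _.
have phiZ a f : phi (a *: f) = a * phi f.
  by rewrite -[a *: f]addr0 phil phi0 addr0.
have [xs|] := pselect (forall f : dual E, (forall y, y \in s -> f y = 0) -> f x = 0).
  apply: IH => // f fs; apply: phis => y; rewrite inE => /predU1P[->|/fs//].
  exact: xs.
move=> /existsNP[f0 /not_implyP[f0s /eqP f0x]].
pose u := (f0 x)^-1 *: f0.
have us y : y \in s -> u y = 0.
  by move=> /f0s f0y; rewrite -[LHS]/((f0 x)^-1 * f0 y) f0y mulr0.
have ux : u x = 1 by exact: mulVf.
have [||y psi_y] := IH (fun f => phi f - f x * phi u).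
- move=> a f g; rewrite phil dualDZE
    -[RHS]/(a * (phi f - f x * phi u) + (phi g - g x * phi u)).
  by rewrite -[a *: phi f]/(a * phi f) -[a *: f x]/(a * f x); ring.
- move=> f fs; have := phis (- f x *: u + f).
  rewrite phil -[_ *: phi u]/(- f x * phi u) => h.
  rewrite -[RHS]h; first by ring.
  move=> y; rewrite inE dualDZE => /predU1P[->|ys].
    by rewrite ux -[- f x *: 1]/(- f x * 1) mulr1 addNr.
  by rewrite (us y ys) (fs y ys) addr0; exact: mulr0.
exists (phi u *: x + y) => f.
have -> : f (phi u *: x + y) = phi u * f x + f y by exact: dual_linear.
by rewrite -psi_y; ring.
Qed.

(** Continuity at 0 bounds [phi] by 1 on a neighbourhood given by finitely many points [s]. If [f]
    kills [s], that neighbourhood contains every multiple of [f], so [phi f = 0] and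
    [functional_span] applies. *)
Theorem weak_star_functional (E : normedModType C) (phi : dual E -> C^o) :
  linear phi -> continuous (phi : weak_star E -> C^o) ->
  exists y, forall f, phi f = f y.
Proof.
move=> phil phic.
pose F := @ptws_filter (dual E) E (fun f x => f x) (fun=> 0) setT.
have FF : Filter F by exact: ptws_filter_filter.
have phi0 : phi 0 = 0.
  have := phil 1 0 0; rewrite !scale1r addr0 => /eqP.
  by rewrite -subr_eq subrr => /eqP.
have F0 : F --> (0 : weak_star E).
  by apply/cvg_weak_star => x; exact: ptws_filter_cvg.
have : F [set f | `|phi f| < 1].
  apply: F0; apply: (phic 0 [set z : C^o | `|z| < 1]); rewrite phi0.
  apply: filterS (@nbhsx_ballx C C^o 0 1 ltr01) => z.
  by rewrite /ball /= sub0r normrN.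
move=> [[s e] /= e0 sP]; apply: (functional_span (s := s)) => // f fs.
have small (n : nat) : `|phi f| * n%:R < 1.
  have phin : phi (n%:R *: f) = n%:R * phi f.
    by rewrite -[n%:R *: f]addr0 phil phi0 addr0.
  have : `|phi (n%:R *: f)| < 1.
    apply: sP; split=> // x xs.
    by rewrite -[X in _ - X]/(n%:R * f x) fs// mulr0 subrr normr0 ltcR.
  by rewrite phin normrM normr_nat mulrC.
apply/eqP; rewrite -normr_le0 real_leNgt ?normr_real//.
apply/negP => /complex_gt0P[r r0 rE].
have := small (Num.bound r^-1); rewrite rE.
have ri : r^-1 < (Num.bound r^-1)%:R by apply: archi_boundP; rewrite invr_ge0 ltW.
rewrite -(rmorph_nat (real_complex R)) -rmorphM ltcR; apply/negP.
by rewrite -leNgt ltW// -ltr_pdivrMl// mulr1.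
Qed.

(** Along an ultrafilter on the ball, the values at [x] converge in the compact disc of radius
    [|x|]; the pointwise limit is linear with norm at most 1. *)
Theorem banach_alaoglu (E : normedModType C) :
  compact ([set f : dual E | `|f| <= 1] : set (weak_star E)).
Proof.
rewrite compact_ultra => F FU F1.
have FP : ProperFilter F := @ultra_proper _ _ FU.
have /choice[l Fl] : forall x : E, exists l : C^o,
    (fun f : dual E => f x : C^o) @ F --> l.
  move=> x; have [|l [_ lx]] :=
    @disc_compact R `|x| ((fun f : dual E => f x : C^o) @ F) _.
    apply: (@filterS _ F _ _ _ _ F1) => f f1.
    apply: le_trans (ler_dual_norm f x) _.
    exact: ler_piMl.
  exists l => A Al; rewrite /nbhs /=.
  have [//|nA] := in_ultra_setVsetC ((fun f : dual E => f x) @^-1` A) FU.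
  by have [z [/= ]] := lx (~` A) A nA Al.
have ll : linear l.
  move=> a x y.
  have h : (fun f : dual E => f (a *: x + y) : C^o) @ F --> (a *: l x + l y : C^o).
    under eq_fun do rewrite linearP.
    by apply: (@cvgD _ C^o); [apply: (@cvgZl_tmp _ C^o); exact: Fl|exact: Fl].
  exact: (cvg_scalar_unique FP (Fl _) h).
have lb x : `|l x| <= 1 * `|x|.
  apply: (cvg_le FP (@cvg_norm _ C^o _ _ _ _ _ (Fl x)) (@cvg_cst C^o _ _ _ _)).
  apply: filterS F1 => f /= f1.
  by rewrite (le_trans (ler_dual_norm _ _))// ler_wpM2r.
exists (Dual (functionalP ll lb)); split.
  exact: dual_norm_le.
by apply/cvg_weak_star => x; exact: Fl.
Qed.

End weak_convergence.

(** * Goldstine's theorem *)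

Section goldstine.
Variables (R : realType) (E : normedModType R[i]).
Local Notation C := R[i].

(** The inner product of the complex numbers as a real plane. *)
Let ip (z w : C) : R := complex.Re z * complex.Re w + complex.Im z * complex.Im w.

Let ip_conj (z w : C) : ip z w = complex.Re (conjc z * w).
Proof. by case: z w => a b [c d]; rewrite /ip /=; ring. Qed.

Let ip_norm (z : C) : ip z z = complex.Re `|z| ^+ 2.
Proof.
by case: z => a b; rewrite /ip /= sqr_sqrtr ?addr_ge0 ?sqr_ge0// !expr2.
Qed.

Let ip_sub (w u : C) (t : R) :
  ip (w - t%:C * u) (w - t%:C * u) = ip w w - t * (2 * ip w u) + t ^+ 2 * ip u u.
Proof. by case: w u => a b [c d]; rewrite /ip /=; ring. Qed.

Let Re_normK (W : normedModType C) (z : W) : (complex.Re `|z|)%:C = `|z|.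
Proof. by rewrite RRe_real// normr_real. Qed.

Let Re_normC (z : C) : (complex.Re `|z|)%:C = `|z|.
Proof. by rewrite RRe_real// normr_real. Qed.

Let Re_norm_ge0 (z : C) : 0 <= complex.Re `|z|.
Proof. by rewrite -ler0c Re_normC. Qed.

Let ReD (a b : C) : complex.Re (a + b) = complex.Re a + complex.Re b.
Proof. by case: a => ? ?; case: b. Qed.

Let rotate (f : dual E) (x : E) : exists2 y, `|y| = `|x| & f y = `|f x|.
Proof.
have [fx0|fx0] := eqVneq (f x) 0; first by exists x; rewrite // fx0 normr0.
exists ((`|f x| / f x) *: x).
  by rewrite normrZ normrM normfV normr_id mulfV ?mul1r ?normr_eq0.
by rewrite dual_linearZ mulfVK.
Qed.

Let small_step (d N : R) : 0 < d -> 0 <= N ->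
  exists t, [/\ 0 < t, t <= 1 & t * (1 + N) <= d / 2].
Proof.
move=> d0 N0; have N1 : 0 < 2 * (1 + N) by rewrite mulr_gt0// ltr_pwDl.
exists (Order.min 1 (d / (2 * (1 + N)))); rewrite lt_min ltr01 divr_gt0//.
rewrite ge_min lexx; split=> //.
have : Order.min 1 (d / (2 * (1 + N))) <= d / (2 * (1 + N)).
  by rewrite ge_min lexx orbT.
by rewrite ler_pdivlMr// ler_pdivlMr// -mulrA [_ * 2]mulrC.
Qed.

(* If the values of no [a] in the unit ball approach those of [L], let [a0]
   almost minimise the Euclidean distance [dist]; the functional [y] pairing
   with [L - a0] then almost attains its norm at [a0], while [L y - y a0] is
   the square of the distance. *)
Theorem goldstine (L : dual (dual E)) (s : seq (dual E)) (e : R) :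
  `|L| <= 1 -> 0 < e ->
  ptws_base (fun a (nu : dual E) => nu a) L [set a : E | `|a| <= 1] (s, e) !=set0.
Proof.
move=> L1 e0; apply: contrapT => noa.
pose dist a := \sum_(nu <- s) ip (L nu - nu a) (L nu - nu a).
have ip_ge0 z : 0 <= ip z z by rewrite ip_norm sqr_ge0.
have dist_e a : `|a| <= 1 -> e ^+ 2 <= dist a.
  move=> a1; rewrite leNgt; apply/negP => ae; apply: noa; exists a; split=> //.
  move=> nu /= nus; rewrite -Re_normK ltcR.
  rewrite -(@ltr_pXn2r _ 2) ?nnegrE ?Re_norm_ge0 ?(ltW e0)//.
  rewrite -ip_norm (le_lt_trans _ ae)// /dist (perm_big _ (perm_to_rem nus)).
  by rewrite big_cons lerDl sumr_ge0.
pose S := [set dist a | a in [set a : E | `|a| <= 1]].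
have infS : has_inf S.
  split; first by exists (dist 0), 0; rewrite //= normr0 ler01.
  by exists (e ^+ 2) => _ [b b1 <-]; exact: dist_e.
pose d := inf S.
have d0 : 0 < d.
  apply: (@lt_le_trans _ _ (e ^+ 2)); first by rewrite exprn_gt0.
  by apply: lb_le_inf infS.1 _ => _ [b b1 <-]; exact: dist_e.
have d_le a : `|a| <= 1 -> d <= dist a.
  by move=> a1; apply: ge_inf; [exact: infS.2|exists a].
(* [N] bounds the quadratic term of the expansion below, as [|k - a0| <= 2] for [k] in the ball. *)
pose N := \sum_(nu <- s) (complex.Re `|nu| * 2) ^+ 2.
have N0 : 0 <= N by apply: sumr_ge0 => nu _; exact: sqr_ge0.
have [t [t0 t1 tN]] := small_step d0 N0.
(* [a0] is minimal up to [t ^+ 2], an excess that becomes [t] after division by [t]. *)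
have [_ [a0 /= a01 <-] a0d] := inf_adherent (exprn_gt0 2 t0) infS.
pose w (nu : dual E) : C := L nu - nu a0.
(* The conjugates make [Re (y x)] the sum of the inner products of [w nu] with [nu x]. *)
pose y : dual E := \sum_(nu <- s) conjc (w nu) *: nu.
have yE x : y x = \sum_(nu <- s) conjc (w nu) * nu x.
  by rewrite /y; elim/big_rec2: _ => // nu _ z _ <-.
have LyE : L y = \sum_(nu <- s) conjc (w nu) * L nu.
  by rewrite /y raddf_sum; apply: eq_bigr => nu _; exact: dual_linearZ.
have Re_sum (F : dual E -> C) :
    complex.Re (\sum_(nu <- s) F nu) = \sum_(nu <- s) complex.Re (F nu).
  by elim/big_rec2: _ => // nu _ z _ <-; exact: ReD.
(* Moving from [a0] towards [k] by [t] stays in the ball, so the squared distance cannot fall below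
   [d]; expanding it bounds the slope. *)
have ya0 k : `|k| <= 1 -> 2 * complex.Re (y (k - a0)) <= t * (1 + N).
  move=> k1; have kt : `|a0 + t%:C *: (k - a0)| <= 1.
    have -> : a0 + t%:C *: (k - a0) = (1 - t)%:C *: a0 + t%:C *: k.
      by rewrite scalerBr rmorphB /= scalerBl scale1r addrA addrAC.
    have t1' : 0 <= 1 - t by rewrite subr_ge0.
    rewrite (le_trans (ler_normD _ _))// !normrZ !normr_real_complex.
    rewrite (ger0_norm t1') (gtr0_norm t0).
    apply: (@le_trans _ _ ((1 - t)%:C * 1 + t%:C * 1)).
      by rewrite lerD// ler_wpM2l// ler0c// ltW.
    by rewrite !mulr1 -rmorphD /= subrK.
  have := d_le _ kt; rewrite /dist.
  have -> : \sum_(nu <- s) ip (L nu - nu (a0 + t%:C *: (k - a0)))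
      (L nu - nu (a0 + t%:C *: (k - a0))) =
      dist a0 - t * (2 * complex.Re (y (k - a0))) +
      t ^+ 2 * \sum_(nu <- s) ip (nu (k - a0)) (nu (k - a0)).
    rewrite yE Re_sum !mulr_sumr /dist -sumrB -big_split /=.
    apply: eq_bigr => nu _; rewrite -ip_conj -ip_sub.
    have -> : nu (a0 + t%:C *: (k - a0)) = nu a0 + t%:C * nu (k - a0).
      by rewrite raddfD /= dual_linearZ.
    by rewrite opprD addrA.
  have leN : \sum_(nu <- s) ip (nu (k - a0)) (nu (k - a0)) <= N.
    apply: ler_sum => nu _; have M0 : 0 <= complex.Re `|nu| * 2.
      by rewrite mulr_ge0// -ler0c Re_normK.
    rewrite ip_norm ler_pXn2r ?nnegrE ?Re_norm_ge0//.
    rewrite -lecR Re_normC.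
    have -> : (complex.Re `|nu| * 2)%:C = `|nu| * 2.
      by rewrite -[in RHS](Re_normK nu) -(rmorph_nat (real_complex R)) -rmorphM.
    rewrite (le_trans (ler_dual_norm _ _))// ler_wpM2l//.
    by rewrite (le_trans (ler_normB _ _))// (le_trans (lerD k1 a01)).
  move: leN; set X := (X in X <= N) => leN h.
  have : t * (2 * complex.Re (y (k - a0))) <= t * (t * (1 + N)).
    have : t ^+ 2 * X <= t ^+ 2 * N by rewrite ler_wpM2l ?sqr_ge0.
    move: a0d h; rewrite -/d.
    set Y := complex.Re _; set D := dist a0; move: (t ^+ 2 * X) (t * (2 * Y)) => P Q.
    rewrite mulrA -expr2 mulrDr mulr1; move: (t ^+ 2) (t ^+ 2 * N) => T2 T3.
    by clear; lra.
  by rewrite ler_pM2l.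
(* The tolerance [d / 4] and the slope bound [d / 4] coming from [tN] give [d <= dist a0 <= d / 2],
   a contradiction. *)
have d4 : 0 < (d / 4)%:C by rewrite ltcR divr_gt0.
have [x [x1 yx]] := dual_norm_approx y d4.
have [k kx yk] := rotate y x.
have k1 : `|k| <= 1 by rewrite kx.
have := ya0 k k1; have := d_le _ a01.
have -> : dist a0 = complex.Re (L y) - complex.Re (y a0).
  rewrite LyE yE !Re_sum -sumrB; apply: eq_bigr => nu _.
  by rewrite ip_conj mulrBr; case: (_ * L nu) => ? ?; case: (_ * nu a0).
have : complex.Re (L y) <= complex.Re (y k) + d / 4.
  have : complex.Re (L y) <= complex.Re `|L y|.
    case: (L y) => p q /=; rewrite (le_trans (ler_norm p))// -sqrtr_sqr.
    by rewrite ler_wsqrtr// lerDl sqr_ge0.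
  move=> /le_trans; apply; rewrite -lecR Re_normK rmorphD /= yk Re_normK.
  rewrite (le_trans _ yx)// (le_trans (ler_dual_norm _ _))//.
  by rewrite ler_piMl.
have -> : complex.Re (y (k - a0)) = complex.Re (y k) - complex.Re (y a0).
  by rewrite raddfB /=; case: (y k) => ? ?; case: (y a0).
move: d0 tN; clear; lra.
Qed.

Lemma goldstine_filter (L : dual (dual E)) : `|L| <= 1 ->
  exists F : set_system E, [/\ ProperFilter F, F [set a | `|a| <= 1] &
    forall nu : dual E, (fun a => nu a) @ F --> L nu].
Proof.
move=> L1.
exists (ptws_filter (fun a (nu : dual E) => nu a) L [set a : E | `|a| <= 1]).
split; [|exact: ptws_filterD|exact: ptws_filter_cvg].
by apply: ptws_filter_proper => s e; exact: goldstine.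
Qed.

End goldstine.

(** * Arens actions and weakly almost periodic functionals *)

Section bidual.
Variables (R : realType) (V : normedModType R[i]).
Local Notation C := R[i].

Fact bidual_eval_linear (x : V) : linear (fun f : dual V => f x : C^o).
Proof. by []. Qed.

Fact bidual_eval_bounded (x : V) (f : dual V) : `|f x| <= `|x| * `|f|.
Proof. by rewrite mulrC ler_dual_norm. Qed.

Definition bidual_eval (x : V) : dual (dual V) :=
  Dual (functionalP (bidual_eval_linear x) (bidual_eval_bounded x)).

Lemma weak_cluster (F : set_system V) (v : V) (f : dual V) (l : C^o) :
  ProperFilter F -> cluster (F : set_system (weak V)) v ->
  (fun x => f x) @ F --> l -> f v = l.
Proof.
move=> FF Fv fl; apply/eqP; rewrite -subr_eq0 -normr_eq0; apply/negPn/negP => fvl.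
have e0 : 0 < `|f v - l| / 2 by rewrite divr_gt0// lt_def fvl normr_ge0.
have A : F [set x | `|l - f x| < `|f v - l| / 2].
  by move/(@cvgrPdist_lt _ C^o) : fl => /(_ _ e0).
have N : nbhs (v : weak V) [set x | `|f v - f x| < `|f v - l| / 2].
  have /cvg_weak/(_ f)/(@cvgrPdist_lt _ C^o)/(_ _ e0) :
    nbhs (v : weak V) --> (v : weak V) by exact: cvg_id.
  exact.
have [x [/= lx vx]] := Fv _ _ A N.
have : `|f v - l| < `|f v - l|.
  have {1}-> : f v - l = (f v - f x) - (l - f x) by rewrite opprB addrA subrK.
  by rewrite (le_lt_trans (ler_normB _ _))// [ltRHS]splitr ltrD.
by rewrite ltxx.
Qed.

End bidual.

(** The points of [V], seen in the bidual, already separate functionals. *)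
Lemma weak_dual_hausdorff (R : realType) (V : normedModType R[i]) :
  hausdorff_space (weak (dual V)).
Proof.
move=> f g fg; apply/dualP => x; apply/esym.
have FF : ProperFilter (nbhs (f : weak (dual V))) by exact: nbhs_pfilter.
apply: (weak_cluster (f := bidual_eval x) FF fg).
have /cvg_weak/(_ (bidual_eval x)) :
  nbhs (f : weak (dual V)) --> (f : weak (dual V)) by exact: cvg_id.
exact.
Qed.

Section arens.
Variables (R : realType) (B : completeNormedModType R[i]) (m : banach_product B).
Local Notation C := R[i].

Section ract.
Variables (b : B) (mu : dual B).

Fact dual_ract_linear : linear (fun a : B => mu (m b a) : C^o).
Proof. by move=> c x y; rewrite bprodPr linearP. Qed.

Fact dual_ract_bounded a : `|mu (m b a)| <= `|mu| * `|b| * `|a|.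
Proof.
by rewrite (le_trans (ler_dual_norm _ _))// -mulrA ler_wpM2l// ler_norm_bprod.
Qed.

Definition dual_ract : dual B :=
  Dual (functionalP dual_ract_linear dual_ract_bounded).

Lemma norm_dual_ract : `|dual_ract| <= `|mu| * `|b|.
Proof. by apply: dual_norm_le; [rewrite mulr_ge0|exact: dual_ract_bounded]. Qed.

End ract.

Lemma norm_dual_lact (a : B) (mu : dual B) : `|dual_lact m a mu| <= `|mu| * `|a|.
Proof.
by apply: dual_norm_le; [rewrite mulr_ge0|exact: dual_lact_bounded].
Qed.

Section arens_actions.
Variables (L : dual (dual B)) (mu : dual B).

Fact arens_lact_linear : linear (fun b : B => L (dual_ract b mu) : C^o).
Proof.
move=> c x y; rewrite -linearP; congr (L _); apply/dualP => a.
by rewrite dualDZE /= bprodPl linearP.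
Qed.

Fact arens_lact_bounded (b : B) :
  `|L (dual_ract b mu)| <= `|L| * `|mu| * `|b|.
Proof.
rewrite (le_trans (ler_dual_norm _ _))// -mulrA ler_wpM2l//.
exact: norm_dual_ract.
Qed.

(* [<L . mu, b> = <L, mu . b>], as in the first Arens product *)
Definition arens_lact : dual B :=
  Dual (functionalP arens_lact_linear arens_lact_bounded).

Lemma norm_arens_lact : `|arens_lact| <= `|L| * `|mu|.
Proof. by apply: dual_norm_le; [rewrite mulr_ge0|exact: arens_lact_bounded]. Qed.

Fact arens_ract_linear : linear (fun b : B => L (dual_lact m b mu) : C^o).
Proof.
move=> c x y; rewrite -linearP; congr (L _); apply/dualP => a.
by rewrite dualDZE /= bprodPr linearP.
Qed.

Fact arens_ract_bounded (b : B) :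
  `|L (dual_lact m b mu)| <= `|L| * `|mu| * `|b|.
Proof.
rewrite (le_trans (ler_dual_norm _ _))// -mulrA ler_wpM2l//.
exact: norm_dual_lact.
Qed.

(* [<mu . L, b> = <L, b . mu>], as in the second Arens product *)
Definition arens_ract : dual B :=
  Dual (functionalP arens_ract_linear arens_ract_bounded).

End arens_actions.

Lemma arens_lactZ (c : C) (L : dual (dual B)) (mu : dual B) :
  arens_lact (c *: L) mu = c *: arens_lact L mu.
Proof. exact/dualP. Qed.

(* A net in the unit ball of [B] converging weak* to [L] is mapped by
   [a |-> a . mu] to a net with a weak cluster point, which can only be
   [L . mu]. *)
Theorem WAP_arens (mu : dual B) (L G : dual (dual B)) :
  WAP m mu -> G (arens_lact L mu) = L (arens_ract G mu).
Proof.
move=> muW.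
have ball_case (L1 : dual (dual B)) : `|L1| <= 1 ->
    G (arens_lact L1 mu) = L1 (arens_ract G mu).
  move=> L1n; have [F [FF F1 FL]] := goldstine_filter L1n.
  pose T a := dual_lact m a mu.
  have FT (H : dual (dual B)) : (fun nu => H nu) @ (T @ F) --> L1 (arens_ract H mu).
    exact: (FL (arens_ract H mu)).
  have FTK : (T @ F) (closure (T @` [set a | `|a| <= 1] : set (weak (dual B)))).
    by apply: (@filterS _ F _ _ _ _ F1) => a a1; apply: subset_closure; exists a.
  have [nu nuT] : exists nu : dual B,
      cluster (T @ F : set_system (weak (dual B))) nu.
    by have [nu [_ nuT]] := muW (T @ F) (fmap_proper_filter T FF) FTK; exists nu.
  have nuE (H : dual (dual B)) : H nu = L1 (arens_ract H mu).
    exact: (weak_cluster (fmap_proper_filter T FF) nuT (FT H)).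
  (* Testing [nu] on evaluations identifies it with [arens_lact L1 mu], since [bidual_eval b] acts
     on the right of [mu] as [b] does. *)
  rewrite -nuE; congr (G _); apply/dualP => b.
  rewrite -[RHS]/(bidual_eval b nu) nuE.
  by congr (L1 _); exact/dualP.
have [->|L0] := eqVneq L 0.
  have -> : arens_lact 0 mu = 0 by exact/dualP.
  exact: raddf0.
have nL : `|L| != 0 by rewrite normr_eq0.
have -> : L = `|L| *: (`|L|^-1 *: L) by rewrite scalerA mulfV// scale1r.
rewrite arens_lactZ dual_linearZ ball_case//.
by rewrite normrZ normfV normr_id mulVf.
Qed.

End arens.

(** The neighbourhoods of [v] pull back along the isometry to a Cauchy filter on the complete space
    [W], whose limit is mapped to [v]. *)
Lemma isometry_range_closed (R : realType) (W : completeNormedModType R[i])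
    (V : normedModType R[i]) (j : W -> V) (v : V) :
  linear j -> (forall x, `|j x| = `|x|) ->
  (forall e : R, 0 < e -> exists x, `|v - j x| < e%:C) -> exists x, v = j x.
Proof.
move=> jl jn vj.
pose J : {linear W -> V} := HB.pack j (GRing.isLinear.Build _ _ _ _ j jl).
have jB x y : j (x - y) = j x - j y := raddfB J x y.
pose S (e : R) := [set x | `|v - j x| < e%:C].
pose F := filter_from [set e : R | 0 < e] S.
have FF : ProperFilter F.
  apply: filter_from_proper; last by move=> e; exact: vj.
  apply: filter_from_filter; first by exists 1; exact: ltr01.
  move=> d e d0 e0; exists (Order.min d e); first by rewrite /= lt_min d0.
  by move=> x xS; split; apply: (lt_le_trans xS); rewrite lecR ge_min lexx ?orbT.
have Fc : cauchy F.
  apply/cauchy_ballP => _ /complex_gt0P[e e0 ->].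
  have e2 : 0 < e / 2 by rewrite divr_gt0.
  exists (S (e / 2), S (e / 2)); first by split; exists (e / 2).
  move=> [x y] [/= xS yS]; rewrite /= -ball_normE /= -jn jB.
  have -> : j x - j y = (v - j y) - (v - j x).
    by rewrite opprB [RHS]addrC addrA subrK.
  by rewrite (le_lt_trans (ler_normB _ _))// [e]splitr rmorphD ltrD.
have /cvg_ex[x Fx] : cvg F by exact: cauchy_cvg.
exists x.
apply/eqP; rewrite -subr_eq0 -normr_le0 real_leNgt ?normr_real//.
apply/negP => /complex_gt0P[e e0 eE]; have e2 : 0 < e / 2 by rewrite divr_gt0.
have A : F (S (e / 2)) by exists (e / 2).
have e2c : 0 < (e / 2)%:C by rewrite ltcR.
have N : F [set y | `|x - y| < (e / 2)%:C].
  by apply: Fx; apply: filterS (nbhsx_ballx x _ e2c) => y; rewrite -ball_normE.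
have [y [yS xy]] := filter_ex (filterI A N).
have : `|v - j x| < e%:C.
  have -> : v - j x = (v - j y) - j (x - y).
    by rewrite jB opprB addrA subrK.
  by rewrite (le_lt_trans (ler_normB _ _))// jn [e]splitr rmorphD ltrD.
by rewrite eE ltxx.
Qed.

(** Outside the closed range, [v] would lie at positive distance from it, and
    [separating_functional] would contradict the hypothesis. *)
Lemma isometry_range_separated (R : realType) (W : completeNormedModType R[i])
    (V : normedModType R[i]) (j : W -> V) (v : V) :
  linear j -> (forall x, `|j x| = `|x|) ->
  (forall F : dual V, (forall x, F (j x) = 0) -> F v = 0) -> exists x, v = j x.
Proof.
move=> jl jn Fv; apply: (isometry_range_closed jl jn) => e e0.
apply: contrapT => /forallNP far.
have far' x : e%:C <= `|v - j x|.
  by rewrite real_leNgt ?normr_real ?ger0_real ?ler0c ?(ltW e0)//; apply/negP/far.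
have [F Fj /eqP] := separating_functional jl e0 far'.
by apply; exact: Fv.
Qed.

(** * Preduals of ultrapowers *)

Lemma continuous_weak_star_eval (R : realType) (V : normedModType R[i]) (x : V) :
  continuous ((fun f : dual V => f x : R[i]^o) : weak_star V -> R[i]^o).
Proof.
move=> f.
have /cvg_weak_star/(_ x) : nbhs (f : weak_star V) --> (f : weak_star V).
  exact: cvg_id.
exact.
Qed.

Lemma continuous_weak_star_evalM (R : realType) (V : normedModType R[i])
    (T : dual V -> dual V) (x : V) :
  continuous (T : weak_star V -> weak_star V) ->
  continuous ((fun f => T f x : R[i]^o) : weak_star V -> R[i]^o).
Proof.
move=> Tc f A Ax; apply: (Tc f [set g : dual V | A (g x)]).
exact: (@continuous_weak_star_eval R V x (T f) A Ax).
Qed.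

(** The hypothesis makes [T] the adjoint of the map sending [x] to [y]. *)
Lemma preadjoint_continuous (R : realType) (V : normedModType R[i])
    (T : dual V -> dual V) :
  (forall x, exists y, forall f, T f x = f y) ->
  continuous (T : weak_star V -> weak_star V).
Proof.
move=> TE f.
have FF : Filter (T @ nbhs (f : weak_star V)) by exact: fmap_filter.
apply/cvg_weak_star => x; have [y yE] := TE x.
rewrite yE => A Ay; apply: (@filterS _ (nbhs (f : weak_star V)) _
  [set g : dual V | A (g y)] [set g : dual V | A (T g x)]) => [g /=|].
  by rewrite yE.
exact: (@continuous_weak_star_eval R V y f A Ay).
Qed.

(** * The module actions on the predual *)

Section dual_banach_algebra_functionals.
Variables (R : realType) (E : completeNormedModType R[i]).
Variables (m : banach_product (dual E)) (Am : dual_banach_algebra m).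
Local Notation C := R[i].

(** [y] is [x . b], which lies in [E] by weak*-continuity of the product. The norm bound keeps
    families of such elements bounded, hence usable in the ultrapower. *)
Lemma predual_ract (b : dual E) (x : E) :
  exists2 y, forall a, m b a x = a y & `|y| <= `|b| * `|x|.
Proof.
have [||y yE] := @weak_star_functional R E (fun a => m b a x).
- by move=> c f g; rewrite bprodPr.
- exact: continuous_weak_star_evalM (Am b).1.
exists y => //; have [f fy f1] := norming_functional y.
rewrite -[`|y|]normr_id -fy -yE (le_trans (ler_dual_norm _ _))// ler_wpM2r//.
by rewrite (le_trans (ler_norm_bprod _ _ _))// ler_piMr.
Qed.

Lemma predual_lact (b : dual E) (x : E) :
  exists2 y, forall a, m a b x = a y & `|y| <= `|b| * `|x|.
Proof.
have [||y yE] := @weak_star_functional R E (fun a => m a b x).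
- by move=> c f g; rewrite bprodPl.
- exact: continuous_weak_star_evalM (Am b).2.
exists y => //; have [f fy f1] := norming_functional y.
rewrite -[`|y|]normr_id -fy -yE (le_trans (ler_dual_norm _ _))// ler_wpM2r//.
by rewrite (le_trans (ler_norm_bprod _ _ _))// ler_piMl.
Qed.

End dual_banach_algebra_functionals.

(** * The ultrapower of [E] inside the dual of that of [E'] *)

Section ultrapower_predual.
Variables (R : realType) (E : completeNormedModType R[i]).
Variables (I : Type) (U : set_system I) (UU : UltraFilter U).
Local Notation C := R[i].
Local Notation X := (ultrapower U E).
Local Notation B := (ultrapower U (dual E)).
Local Notation j := (@predual_embedding R I U UU E).

Lemma predual_embedding_linear : linear j.
Proof. by move=> c x y; apply/dualP => a; exact: ultra_pairing_linearr. Qed.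

(** Norming functionals of the components form an element of the unit ball of [B] at which [j x]
    takes the value [|x|]. *)
Lemma norm_predual_embedding (x : X) : `|j x| = `|x|.
Proof.
apply/eqP; rewrite eq_le; apply/andP; split.
  exact: (@dual_norm_le _ _ (j x) _ (normr_ge0 x) (ler_norm_ultra_pairing_sym x)).
pose r := repr x.
have /choice[f fP] : forall i, exists f : dual E, f (r i) = `|r i| /\ `|f| <= 1.
  by move=> i; have [f fr f1] := norming_functional (r i); exists f.
pose a := Linfty (bounded_familyP (fun i => (fP i).2)).
have a1 : `|uclass U a| <= 1.
  by apply: norm_uclass_le; apply: nearW => i; exact: (fP i).2.
have jxa : j x (uclass U a) = `|x|.
  rewrite -[in RHS](uclass_repr x) /=.
  apply/esym/(cvg_scalar_unique ultra_proper (@norm_uclass _ _ U UU _ r)).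
  have := @cvg_ultra_pairing _ _ U UU _ a r; rewrite uclass_repr.
  by under eq_fun do rewrite /= (fP _).1.
rewrite -[leLHS]normr_id -jxa (le_trans (ler_dual_norm _ _))//.
by rewrite ler_piMr.
Qed.

Lemma predual_embedding_inj : injective j.
Proof.
move=> x y jxy; apply/eqP; rewrite -subr_eq0 -normr_eq0 -norm_predual_embedding.
have -> : j (x - y) = 0.
  by rewrite -scaleN1r addrC predual_embedding_linear jxy scaleN1r addNr.
by rewrite normr0.
Qed.

Variables (m : banach_product (dual E)) (Am : dual_banach_algebra m).
Local Notation P := (ultra_product U m).

(** The preimage is built componentwise from [predual_ract]; with the next lemma, [range j] is a
    sub-bimodule. *)
Lemma predual_embedding_ract (b : B) (x : X) : exists y, j y = dual_ract P b (j x).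
Proof.
have /choice[y yP] : forall i, exists y : E,
    (forall a, m (repr b i) a (repr x i) = a y) /\
    `|y| <= `|repr b i| * `|repr x i|.
  by move=> i; have [y] := predual_ract Am (repr b i) (repr x i); exists y.
have [M M0 bM] := linfty_bounded (repr b); have [N N0 xN] := linfty_bounded (repr x).
have yb i : `|y i| <= M * N.
  by rewrite (le_trans (yP i).2)// ler_pM.
exists (uclass U (Linfty (bounded_familyP yb))); apply/dualP => a.
have := @cvg_ultra_pairing _ _ U UU _ (repr a) (Linfty (bounded_familyP yb)).
rewrite uclass_repr => /(cvg_scalar_unique ultra_proper); apply.
have := @cvg_ultra_pairing _ _ U UU _ (linfty_prod m (repr b) (repr a)) (repr x).
rewrite -ultra_prod_uclass !uclass_repr.
by under eq_fun do rewrite /= (yP _).1.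
Qed.

Lemma predual_embedding_lact (b : B) (x : X) : exists y, j y = dual_lact P b (j x).
Proof.
have /choice[y yP] : forall i, exists y : E,
    (forall a, m a (repr b i) (repr x i) = a y) /\
    `|y| <= `|repr b i| * `|repr x i|.
  by move=> i; have [y] := predual_lact Am (repr b i) (repr x i); exists y.
have [M M0 bM] := linfty_bounded (repr b); have [N N0 xN] := linfty_bounded (repr x).
have yb i : `|y i| <= M * N.
  by rewrite (le_trans (yP i).2)// ler_pM.
exists (uclass U (Linfty (bounded_familyP yb))); apply/dualP => a.
have := @cvg_ultra_pairing _ _ U UU _ (repr a) (Linfty (bounded_familyP yb)).
rewrite uclass_repr => /(cvg_scalar_unique ultra_proper); apply.
have := @cvg_ultra_pairing _ _ U UU _ (linfty_prod m (repr a) (repr b)) (repr x).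
rewrite -ultra_prod_uclass !uclass_repr.
by under eq_fun do rewrite /= (yP _).1.
Qed.

(** The Arens actions require elements of the bidual of [B], so [Phi] is transported to [range j]
    and extended by Hahn-Banach. *)
Lemma predual_extension (Phi : dual X) :
  exists2 L : dual (dual B), forall x, L (j x) = Phi x & `|L| <= `|Phi|.
Proof.
have nE : (complex.Re `|Phi|)%:C = `|Phi| by rewrite RRe_real// normr_real.
have [||||L LE Ln] := @hahn_banach R (dual B) X j Phi (complex.Re `|Phi|).
- exact: predual_embedding_linear.
- exact: dual_linear.
- by rewrite -ler0c nE.
- by move=> x; rewrite nE norm_predual_embedding ler_dual_norm.
by exists L => //; rewrite -nE.
Qed.

(** * From weak almost periodicity to the product *)

Section wap_to_product.
Hypothesis wapX : range j `<=` WAP P.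

(* Both Arens actions of the bidual of [B] on [j x] stay in the closed
   subspace [range j]: a functional [G] vanishing there satisfies
   [G (L . j x) = L (j x . G)], and [j x . G = 0] as [range j] is a
   sub-bimodule. *)
Lemma predual_embedding_arens_lact (L : dual (dual B)) (x : X) :
  exists y, j y = arens_lact P L (j x).
Proof.
have [||G Gj|y yE] :=
  @isometry_range_separated R X (dual B) j (arens_lact P L (j x)).
- exact: predual_embedding_linear.
- exact: norm_predual_embedding.
- rewrite WAP_arens; last by apply: wapX; exists x.
  have -> : arens_ract P G (j x) = 0.
    apply/dualP => b; have [y yE] := predual_embedding_lact b x.
    by rewrite /= -yE Gj.
  by rewrite raddf0.
by exists y.
Qed.

Lemma predual_embedding_arens_ract (G : dual (dual B)) (x : X) :
  exists y, j y = arens_ract P G (j x).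
Proof.
have [||L Lj|y yE] :=
  @isometry_range_separated R X (dual B) j (arens_ract P G (j x)).
- exact: predual_embedding_linear.
- exact: norm_predual_embedding.
- rewrite -WAP_arens; last by apply: wapX; exists x.
  have -> : arens_lact P L (j x) = 0.
    apply/dualP => b; have [y yE] := predual_embedding_ract b x.
    by rewrite /= -yE Lj.
  by rewrite raddf0.
by exists y.
Qed.

Lemma wap_product : exists M : banach_product (dual X),
  dual_banach_algebra M /\
  forall a b : B, M (dual_embedding a) (dual_embedding b) = dual_embedding (P a b).
Proof.
(* In [X], [rX (x, b)] is [x . b], [lX (Psi, x)] is [Psi . x] and [sX (Phi, x)] is [x . Phi]. *)
have /choice[rX rXE] : forall p : X * B, exists y, j y = dual_ract P p.2 (j p.1).
  by move=> [x b]; exact: predual_embedding_ract.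
have /choice[ext extP] : forall Phi : dual X, exists L : dual (dual B),
    (forall x, L (j x) = Phi x) /\ `|L| <= `|Phi|.
  by move=> Phi; have [L] := predual_extension Phi; exists L.
have extE (Phi : dual X) x : ext Phi (j x) = Phi x by exact: (extP Phi).1.
have /choice[lX lXE] : forall p : dual X * X,
    exists y, j y = arens_lact P (ext p.1) (j p.2).
  by move=> [Psi x]; exact: predual_embedding_arens_lact.
have /choice[sX sXE] : forall p : dual X * X,
    exists y, j y = arens_ract P (ext p.1) (j p.2).
  by move=> [Psi x]; exact: predual_embedding_arens_ract.
have swap (Phi Psi : dual X) x : Phi (lX (Psi, x)) = Psi (sX (Phi, x)).
  have jW : WAP P (j x) by apply: wapX; exists x.
  have := WAP_arens (ext Psi) (ext Phi) jW.
  by rewrite -(lXE (Psi, x)) -(sXE (Phi, x)) !extE.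
(* As [x . b] lies in [X], [Psi . x] depends on [Psi] alone and not on the extension chosen by
   [ext]. *)
have lXb (Psi : dual X) x b : j (lX (Psi, x)) b = Psi (rX (x, b)).
  by rewrite lXE /= -extE rXE.
have lXl (Psi : dual X) c x y :
    lX (Psi, c *: x + y) = c *: lX (Psi, x) + lX (Psi, y).
  apply: predual_embedding_inj; rewrite predual_embedding_linear; apply/dualP => b.
  rewrite dualDZE !lXb -linearP; congr (Psi _); apply: predual_embedding_inj.
  by rewrite predual_embedding_linear !rXE predual_embedding_linear; exact/dualP.
have lXn (Psi : dual X) x : `|lX (Psi, x)| <= `|Psi| * `|x|.
  rewrite -norm_predual_embedding lXE (le_trans (norm_arens_lact _ _ _))//.
  by rewrite norm_predual_embedding ler_wpM2r// (extP Psi).2.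
have Ml (Phi Psi : dual X) : linear (fun x => Phi (lX (Psi, x)) : C^o).
  by move=> c x y; rewrite lXl linearP.
have Mn (Phi Psi : dual X) x : `|Phi (lX (Psi, x))| <= `|Phi| * `|Psi| * `|x|.
  by rewrite (le_trans (ler_dual_norm _ _))// -mulrA ler_wpM2l.
pose M (Phi Psi : dual X) : dual X := Dual (functionalP (Ml Phi Psi) (Mn Phi Psi)).
have rXA x b c : rX (rX (x, b), c) = rX (x, P b c).
  apply: predual_embedding_inj; rewrite !rXE; apply/dualP => a.
  exact: (congr1 (j x) (bprodA P b c a)).
(* The left action of functionals commutes with the right action of [B]; associativity reduces to
   this once tested on [b]. *)
have lXr Theta x b : lX (Theta, rX (x, b)) = rX (lX (Theta, x), b).
  apply: predual_embedding_inj; apply/dualP => c; rewrite lXb rXA rXE /=.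
  by rewrite -[RHS]/(j (lX (Theta, x)) (P b c)) lXb.
have MA : associative M.
  move=> Phi Psi Theta; apply/dualP => x /=; congr (Phi _).
  apply: predual_embedding_inj; apply/dualP => b.
  by rewrite !lXb -[LHS]/(Psi (lX (Theta, rX (x, b)))) lXr.
have MPl c Phi1 Phi2 Psi : M (c *: Phi1 + Phi2) Psi = c *: M Phi1 Psi + M Phi2 Psi.
  exact/dualP.
(* The choice [ext] need not be linear, so linearity in the second variable is read off the
   expression through [sX]. *)
have MPr c Phi Psi1 Psi2 : M Phi (c *: Psi1 + Psi2) = c *: M Phi Psi1 + M Phi Psi2.
  by apply/dualP => x; rewrite dualDZE /= !swap dualDZE.
have Mnorm Phi Psi : `|M Phi Psi| <= `|Phi| * `|Psi|.
  by apply: dual_norm_le; [rewrite mulr_ge0|exact: Mn].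
exists (BanachProduct MA MPl MPr Mnorm); split.
  move=> Phi; split; apply: preadjoint_continuous => x.
    by exists (sX (Phi, x)) => Psi; exact: swap.
  by exists (lX (Phi, x)).
move=> a b; apply/dualP => x /=.
rewrite -[LHS]/(j (lX (dual_embedding b, x)) a) lXb.
by rewrite -[LHS]/(j (rX (x, a)) b) rXE.
Qed.

End wap_to_product.

Lemma product_wap (M : banach_product (dual X)) :
  dual_banach_algebra M ->
  (forall a b : B,
     M (dual_embedding a) (dual_embedding b) = dual_embedding (P a b)) ->
  range j `<=` WAP P.
Proof.
move=> MD ME _ [x _ <-].
(* [y Phi] is [Phi . x], found in [X] by weak*-continuity in the left factor. *)
have /choice[y yE] : forall Phi : dual X,
    exists y, forall Phi', M Phi' Phi x = Phi' y.
  move=> Phi; apply: weak_star_functional.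
    by move=> c f g; rewrite bprodPl.
  exact: continuous_weak_star_evalM (MD Phi).2.
pose T Phi : dual B := j (y Phi).
have Tc : continuous (T : weak_star X -> weak (dual B)).
  move=> Phi.
  have FF : Filter (T @ nbhs (Phi : weak_star X)) by exact: fmap_filter.
  apply/cvg_weak => G.
  (* [Gj] is [G] restricted along [j]: testing [T] against [G] becomes left multiplication by [Gj]
     evaluated at [x], which is weak*-continuous. *)
  have Gl : linear (fun z => G (j z) : C^o).
    by move=> c z w; rewrite predual_embedding_linear linearP.
  have Gn z : `|G (j z)| <= `|G| * `|z|.
    by rewrite -(norm_predual_embedding z) ler_dual_norm.
  pose Gj : dual X := Dual (functionalP Gl Gn).
  have GT (Psi : dual X) : G (T Psi) = M Gj Psi x by rewrite yE.
  rewrite GT => A AM; apply: (@filterS _ (nbhs (Phi : weak_star X)) _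
    [set Psi : dual X | A (M Gj Psi x)] [set Psi : dual X | A (G (T Psi))]).
    by move=> Psi /=; rewrite GT.
  exact: (@continuous_weak_star_evalM _ _ (M Gj) x (MD Gj).1 Phi A AM).
have Kc : compact (T @` [set Phi | `|Phi| <= 1] : set (weak (dual B))).
  apply: (@continuous_compact (weak_star X) (weak (dual B)));
    last exact: banach_alaoglu.
  exact: continuous_subspaceT.
apply: (subclosed_compact _ Kc); first exact: closed_closure.
(* The image of the ball is closed, so it suffices that it contains each [a . j x] with [|a| <= 1];
   this is [T (dual_embedding a)], because [M] extends the product of [B]. *)
have /closure_id -> := compact_closed (@weak_dual_hausdorff R B) Kc.
apply: closure_subset => _ [a a1 <-].
exists (dual_embedding a); first by rewrite /= norm_dual_embedding.
apply/dualP => b; rewrite -[LHS]/(dual_embedding b (y (dual_embedding a))) -yE ME.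
by [].
Qed.

End ultrapower_predual.

Theorem proposition3p5 (R : realType) (E : completeNormedModType R[i])
    (m : banach_product (dual E)) (Am : dual_banach_algebra m)
    (I : Type) (U : set_system I) (UU : UltraFilter U) :
  (exists M : banach_product (dual (ultrapower U E)),
     dual_banach_algebra M /\
     forall a b : ultrapower U (dual E),
       M (dual_embedding a) (dual_embedding b) =
       dual_embedding (ultra_product U m a b))
  <->
  range (@predual_embedding R I U UU E)
    `<=` WAP (ultra_product U m).
Proof.
split=> [[M [MD ME]]|wapX]; first exact: product_wap MD ME.
exact: wap_product Am wapX.
Qed.
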